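(* Let $\Gamma$ be a finite simple graph with at least one vertex and let $G$ be the right-angled Artin group with defining graph $\Gamma$. Then the spherical exponential growth rate $\alpha(G)$ of $G$ with respect to its standard symmetric set of generators $\{v : v\in V\Gamma\}\cup\{v^{-1} : v\in V\Gamma\}$ is either equal to $1$ or a Perron number.
   Context: The right-angled Artin group defined by a simple graph $\Gamma$ with vertex set $V\Gamma$ and edge set $E\Gamma$ is the group with presentation $$G=\langle v\in V\Gamma \mid [u,v]=1 \text{ if } (u,v)\in E\Gamma\rangle .$$ Its standard symmetric generating set is $S=\{v : v\in V\Gamma\}\cup\{v^{-1} : v\in V\Gamma\}$. The word-length of $g\in G$ is the minimum length of a word over $S$ representing $g$. Let $a_l$ be the number of elements of $G$ of word-length $l$. The spherical exponential growth rate of $G$ with respect to $S$ is $\alpha(G)=\limsup_{l\to\infty}\sqrt[l]{a_l}$. A Perron number is a real algebraic integer bigger than $1$ which is strictly greater in absolute value than any of its other Galois conjugates. *)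

(* Defs.v *)
From HB Require Import structures.
From mathcomp Require Import all_boot all_order all_algebra.
From mathcomp Require Import finmap.
From mathcomp Require Import all_classical all_reals all_analysis.
From mathcomp Require Import generic_quotient.
From mathcomp.real_closed Require Import complex.

Set Implicit Arguments.
Unset Strict Implicit.
Unset Printing Implicit Defensive.

Import Order.TTheory GRing.Theory Num.Theory.
Local Open Scope classical_set_scope.
Local Open Scope quotient_scope.
Local Open Scope ring_scope.

(* In a word over the alphabet [X] and its formal inverses, the letter        *)
(* [(x, false)] stands for x and [(x, true)] for x^-1.                        *)
Section Presentation.
Variable X : choiceType.

Definition gword := seq (X * bool).
Definition invl (a : X * bool) : X * bool := (a.1, ~~ a.2).
Definition invw (w : gword) : gword := map invl (rev w).

Variable rels : set gword.

(* The smallest congruence on words identifying every relator and every word  *)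
(* x x^-1, x^-1 x with the empty word: equality in the group < X | rels >.    *)
Inductive pres_eq : gword -> gword -> Prop :=
| pres_refl w : pres_eq w w
| pres_sym u v : pres_eq u v -> pres_eq v u
| pres_trans v u w : pres_eq u v -> pres_eq v w -> pres_eq u w
| pres_free u a v : pres_eq (u ++ [:: a; invl a] ++ v) (u ++ v)
| pres_rel u r v : rels r -> pres_eq (u ++ r ++ v) (u ++ v).

Lemma invlK : involutive invl.
Proof. by case=> x b; rewrite /invl /= negbK. Qed.

Lemma invw_cat u v : invw (u ++ v) = invw v ++ invw u.
Proof. by rewrite /invw rev_cat map_cat. Qed.

Lemma pres_eq_cat p s u v : pres_eq u v -> pres_eq (p ++ u ++ s) (p ++ v ++ s).
Proof.
elim=> {u v} [w|u v _ IH|v u w _ IH1 _ IH2|u a v|u r v rr].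
- exact: pres_refl.
- exact: pres_sym.
- exact: pres_trans IH1 IH2.
- by have := pres_free (p ++ u) a (v ++ s); rewrite -!catA.
- by have := pres_rel (p ++ u) (v ++ s) rr; rewrite -!catA.
Qed.

Lemma pres_eq_cat2 u u' v v' :
  pres_eq u u' -> pres_eq v v' -> pres_eq (u ++ v) (u' ++ v').
Proof.
move=> uu vv; apply: (@pres_trans (u' ++ v)).
  exact: (pres_eq_cat [::] v uu).
by have := pres_eq_cat u' [::] vv; rewrite !cats0.
Qed.

Lemma pres_eq_invr w : pres_eq (w ++ invw w) [::].
Proof.
elim: w => [|a w IH]; first exact: pres_refl.
rewrite -cat1s invw_cat -catA.
apply: pres_trans (pres_free [::] a [::]).
by have := pres_eq_cat [:: a] (invw [:: a]) IH; rewrite -!catA.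
Qed.

Lemma invwK : involutive invw.
Proof.
move=> w; rewrite /invw -map_rev revK -map_comp map_id_in // => a _.
exact: invlK.
Qed.

Lemma pres_eq_invl w : pres_eq (invw w ++ w) [::].
Proof. by have := pres_eq_invr (invw w); rewrite invwK. Qed.

Lemma pres_eq_invw u v : pres_eq u v -> pres_eq (invw u) (invw v).
Proof.
move=> uv; apply: (@pres_trans (invw u ++ (v ++ invw v))).
  by have := pres_eq_cat (invw u) [::] (pres_sym (pres_eq_invr v));
    rewrite !cats0.
apply: (@pres_trans ((invw u ++ u) ++ invw v)).
  rewrite -catA; apply: pres_eq_cat2; first exact: pres_refl.
  by apply: pres_eq_cat2; [exact: pres_sym|exact: pres_refl].
exact: (pres_eq_cat [::] (invw v) (pres_eq_invl u)).
Qed.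

Definition pres_eqb (u v : gword) : bool := `[< pres_eq u v >].

Lemma pres_eqb_refl : reflexive pres_eqb.
Proof. by move=> w; apply/asboolP/pres_refl. Qed.

Lemma pres_eqb_sym : symmetric pres_eqb.
Proof. by move=> u v; apply/asboolP/asboolP; exact: pres_sym. Qed.

Lemma pres_eqb_trans : transitive pres_eqb.
Proof.
by move=> v u w /asboolP uv /asboolP vw; apply/asboolP/(pres_trans uv vw).
Qed.

Canonical pres_equiv :=
  EquivRel pres_eqb pres_eqb_refl pres_eqb_sym pres_eqb_trans.

Definition presented := {eq_quot pres_equiv}.
HB.instance Definition _ := Choice.on presented.

Definition word_class (w : gword) : presented := \pi_({eq_quot pres_equiv}) w.
Definition pres_mul (g h : presented) : presented :=
  word_class (repr g ++ repr h).
Definition pres_one : presented := word_class [::].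
Definition pres_inv (g : presented) : presented := word_class (invw (repr g)).

Lemma word_classP u v : word_class u = word_class v <-> pres_eq u v.
Proof.
by split=> [/eqmodP /asboolP //|uv]; apply/eqmodP/asboolP.
Qed.

Lemma word_class_repr (g : presented) : word_class (repr g) = g.
Proof. exact: reprK. Qed.

Lemma pres_eq_repr w : pres_eq (repr (word_class w)) w.
Proof. by apply/word_classP; rewrite word_class_repr. Qed.

Lemma pres_mulA : associative pres_mul.
Proof.
move=> f g h; apply/word_classP.
apply: (@pres_trans (repr f ++ (repr g ++ repr h))).
  by apply: pres_eq_cat2; [exact: pres_refl|exact: pres_eq_repr].
rewrite catA; apply: pres_eq_cat2; last exact: pres_refl.
exact/pres_sym/pres_eq_repr.
Qed.

Lemma pres_mul1 : left_id pres_one pres_mul.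
Proof.
move=> g; rewrite -[RHS]word_class_repr; apply/word_classP.
exact: (pres_eq_cat2 (pres_eq_repr [::]) (pres_refl _)).
Qed.

Lemma pres_mulr1 : right_id pres_one pres_mul.
Proof.
move=> g; rewrite -[RHS]word_class_repr; apply/word_classP.
rewrite -[X in pres_eq _ X]cats0.
exact: (pres_eq_cat2 (pres_refl _) (pres_eq_repr [::])).
Qed.

Lemma pres_mulV : left_inverse pres_one pres_inv pres_mul.
Proof.
move=> g; apply/word_classP.
apply: pres_trans (pres_eq_invl (repr g)).
by apply: pres_eq_cat2; [exact: pres_eq_repr|exact: pres_refl].
Qed.

Lemma pres_mulrV : right_inverse pres_one pres_inv pres_mul.
Proof.
move=> g; apply/word_classP.
apply: pres_trans (pres_eq_invr (repr g)).
by apply: pres_eq_cat2; [exact: pres_refl|exact: pres_eq_repr].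
Qed.

HB.instance Definition _ := isGroup.Build presented
  pres_mulA pres_mul1 pres_mulr1 pres_mulV pres_mulrV.

Definition pres_gen (x : X) : presented := word_class [:: (x, false)].

End Presentation.

(* Commutator convention: [u, v] = u^-1 v^-1 u v.                             *)
Definition raag_rels (V : finType) (e : rel V) : set (gword V) :=
  [set r | exists u v, e u v /\
     r = [:: (u, true); (v, true); (u, false); (v, false)]].

Definition raag (V : finType) (e : rel V) : groupType :=
  presented (raag_rels e).

Definition raag_gens (V : finType) (e : rel V) : set (raag e) :=
  [set g | exists v : V,
     g = pres_gen (raag_rels e) v \/ g = ((pres_gen (raag_rels e) v)^-1)%g].

Section Growth.
Variables (G : groupType) (S : set G).

Definition represents (w : seq G) (g : G) : Prop :=
  (forall s, s \in w -> S s) /\ (\prod_(s <- w) s)%g = g.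

Definition has_word_length (g : G) (l : nat) : Prop :=
  (exists w, represents w g /\ size w = l) /\
  (forall w, represents w g -> (l <= size w)%N).

(* [fset_set] of an infinite set is empty; spheres are finite whenever the    *)
(* generating set is.                                                         *)
Definition sphere_card (l : nat) : nat :=
  #|` fset_set [set g | has_word_length g l]|.

Definition growth_rate (R : realType) : \bar R :=
  limn_esup (fun l : nat => ((sphere_card l)%:R `^ (l%:R^-1))%:E).

End Growth.

(* [p] is forced to be the minimal polynomial of z over the rationals.        *)
Definition galois_conjugate (C : numClosedFieldType) (z w : C) : Prop :=
  exists p : {poly rat}, [/\ p \is monic, irreducible_poly p,
    root (map_poly ratr p) z & root (map_poly ratr p) w].

Definition perron (R : realType) (x : R) : Prop :=
  [/\ integralOver (intr : int -> R) x, 1 < x &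
    forall z : R[i], galois_conjugate (x%:C)%C z -> z != (x%:C)%C ->
      `|z| < `|(x%:C)%C|].

(* Main.v *)
From HB Require Import structures.
Require Import Defs.
From mathcomp Require Import all_boot all_order all_algebra.
From mathcomp Require Import finmap.
From mathcomp Require Import all_classical all_reals all_analysis.
From mathcomp.real_closed Require Import complex polyrcf.
From mathcomp Require Import fintype finset.
From mathcomp Require Import ring lra zify.

(** For a set [U] of vertices let D_U be the integer polynomial
    [sum over cliques K of U of (-2 X)^|K| (1 + X)^(|U| - |K|)]. The growth
    series of the group of [U] is (1 + X)^|U| / D_U. Hence the growth rate is
    the inverse of the radius of convergence of 1 / D_V, and everything rests on
    locating the roots of D_V of smallest modulus.

    The formula for the growth series comes from normal forms. A word is
    recorded by its stacks, one for each pair of nonadjacent (or equal)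
    vertices, which list the letters of the word at these two vertices. Stacks
    identify exactly the words that differ by exchanging adjacent commuting
    letters; reduced words up to such exchanges form a set on which the group
    acts, so that two reduced words have the same value exactly when they have
    the same stacks ([reduced_val]), and reduced words are geodesic
    ([has_word_lengthP]). The letters that are on top of all their stacks are
    the possible first letters of a geodesic. Counting the elements of a sphere
    no geodesic of which starts in [U] gives a recursion in [U]
    ([avoid_series_setU1]), which up to powers of 1 + X is that of D_U
    ([clique_poly_setU1]); for [U] empty the count is the growth series, and for [U] everything it is 1.

    Let [v] be a vertex outside [U] and [L] the set of its neighbours in [U].
    The recursion says that D_(v + U) = D_U (1 - B) with
    [B = X + 2 X (C - 1)], where C = (1 + X)^(|U| - |L|) D_L / D_U. The series C
    counts coset representatives, so it has nonnegative coefficients; this is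
    proved algebraically, by induction on the graph, because 1 / (1 - B) is
    nonnegative when [B] is ([coset_series_nonneg]). The linear coefficient of
    [B] is 1.

    By induction D_U has a positive root rho' that is its only root in the
    closed disc of radius rho' (for [U] empty, take any number above 1). Let rho
    be the largest number at most rho' with B(rho) <= 1. If t is a root of
    D_(v + U) with |t| <= rho and D_U(t) is not 0, then B(t) = 1 although the
    series of absolute values is at most 1. Since the linear term of [B] is t
    itself, this forces t to be a positive real number, and then t = rho by
    strict monotony ([root_on_circle]). Thus rho is the only root of D_(v + U)
    in its closed disc, it is at most 1, and 1 / D_(v + U) converges in the open
    disc.

    Finally the growth rate is 1 / rho, where now rho belongs to D_V. If rho is
    less than 1, this is a Perron number: it is a root of the reversal of D_V,
    which is monic with integer coefficients because D_V has constant
    coefficient 1; its other conjugates are roots of the same polynomial, so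
    their inverses are roots of D_V other than rho, of modulus greater than rho. *)

Set Implicit Arguments.
Unset Strict Implicit.
Unset Printing Implicit Defensive.
Import Order.TTheory GRing.Theory Num.Theory.
Import numFieldNormedType.Exports.
Local Open Scope ring_scope.
Local Open Scope complex_scope.

(** * Formal power series *)

(** Power series are wrapped in a record because functions [nat -> R] already
    carry the pointwise product. *)
Record fps (R : Type) := Fps { fcoef : nat -> R }.

Lemma fpsP (R : Type) (f g : fps R) : fcoef f =1 fcoef g <-> f = g.
Proof.
by split=> [|-> //]; case: f; case: g => f g /= fg; congr Fps; apply/funext.
Qed.

HB.instance Definition _ (R : Type) := gen_eqMixin (fps R).
HB.instance Definition _ (R : Type) := gen_choiceMixin (fps R).

Section FpsRing.
Variable R : comNzRingType.
Implicit Types f g h : fps R.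

Definition fps_zero := Fps (fun=> 0 : R).
Definition fps_add f g := Fps (fun n => fcoef f n + fcoef g n).
Definition fps_opp f := Fps (fun n => - fcoef f n).
Definition fps_one := Fps (fun n => (n == 0)%:R : R).
Definition fps_mul f g :=
  Fps (fun n => \sum_(i < n.+1) fcoef f i * fcoef g (n - i)).

Definition fps_trunc N f : {poly R} := \poly_(i < N) fcoef f i.

(** Products of series are computed on truncations, which transfers the ring
    laws from polynomials. *)
Lemma fps_mul_trunc N f g n : (n < N)%N ->
  fcoef (fps_mul f g) n = (fps_trunc N f * fps_trunc N g)`_n.
Proof.
move=> nN; rewrite coefM; apply: eq_bigr => i _.
by rewrite !coef_poly !ifT //; have := ltn_ord i; lia.
Qed.

Fact fps_addA : associative fps_add.
Proof. by move=> f g h; apply/fpsP => n /=; rewrite addrA. Qed.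
Fact fps_addC : commutative fps_add.
Proof. by move=> f g; apply/fpsP => n /=; rewrite addrC. Qed.
Fact fps_add0 : left_id fps_zero fps_add.
Proof. by move=> f; apply/fpsP => n /=; rewrite add0r. Qed.
Fact fps_addN : left_inverse fps_zero fps_opp fps_add.
Proof. by move=> f; apply/fpsP => n /=; rewrite addNr. Qed.
HB.instance Definition _ :=
  GRing.isZmodule.Build (fps R) fps_addA fps_addC fps_add0 fps_addN.

Fact fps_mulC : commutative fps_mul.
Proof.
by move=> f g; apply/fpsP => n; rewrite !(fps_mul_trunc _ _ (ltnSn n)) mulrC.
Qed.

Fact fps_mulA : associative fps_mul.
Proof.
move=> f g h; apply/fpsP => n.
have tr (a b c : fps R) : fcoef (fps_mul (fps_mul a b) c) n =
    (fps_trunc n.+1 a * fps_trunc n.+1 b * fps_trunc n.+1 c)`_n.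
  rewrite (fps_mul_trunc _ _ (ltnSn n)) coefM [RHS]coefM.
  apply: eq_bigr => i _; rewrite coef_poly ltn_ord.
  by rewrite (fps_mul_trunc _ _ (ltn_ord i)).
by rewrite fps_mulC !tr (mulrC _ (fps_trunc _ f)) mulrA.
Qed.

Fact fps_mul1 : left_id fps_one fps_mul.
Proof.
move=> f; apply/fpsP => n /=; rewrite big_ord_recl /= subn0 mul1r.
by rewrite big1 ?addr0 // => i _; rewrite mul0r.
Qed.

Fact fps_mulDl : left_distributive fps_mul fps_add.
Proof.
move=> f g h; apply/fpsP => n /=; rewrite -big_split /=.
by apply: eq_bigr => i _; rewrite mulrDl.
Qed.

Fact fps_one_neq0 : fps_one != fps_zero.
Proof. by apply/eqP => /fpsP /(_ 0)/eqP; rewrite oner_eq0. Qed.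

HB.instance Definition _ := GRing.Zmodule_isComNzRing.Build (fps R)
  fps_mulA fps_mulC fps_mul1 fps_mulDl fps_one_neq0.

Lemma fcoef1 n : fcoef (1 : fps R) n = (n == 0)%:R. Proof. by []. Qed.
Lemma fcoefD f g n : fcoef (f + g) n = fcoef f n + fcoef g n.
Proof. by []. Qed.
Lemma fcoefB f g n : fcoef (f - g) n = fcoef f n - fcoef g n.
Proof. by []. Qed.
Lemma fcoefM f g n :
  fcoef (f * g) n = \sum_(i < n.+1) fcoef f i * fcoef g (n - i).
Proof. by []. Qed.
Lemma fcoefM0 f g : fcoef (f * g) 0 = fcoef f 0 * fcoef g 0.
Proof. by rewrite fcoefM big_ord1. Qed.
Definition fps_of_poly (p : {poly R}) : fps R := Fps (fun n => p`_n).

Fact fps_of_poly_is_zmod : zmod_morphism fps_of_poly.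
Proof. by move=> p q; apply/fpsP => n; rewrite fcoefB /= coefB. Qed.
Fact fps_of_poly_is_monoid : monoid_morphism fps_of_poly.
Proof.
split=> [|p q]; apply/fpsP => n; first by rewrite fcoef1 /= coef1.
by rewrite fcoefM /= coefM.
Qed.
HB.instance Definition _ :=
  GRing.isZmodMorphism.Build _ _ fps_of_poly fps_of_poly_is_zmod.
HB.instance Definition _ :=
  GRing.isMonoidMorphism.Build _ _ fps_of_poly fps_of_poly_is_monoid.

Definition fpsX : fps R := fps_of_poly 'X.

Lemma fcoefXM f n : fcoef (fpsX * f) n = if n is m.+1 then fcoef f m else 0.
Proof.
rewrite fcoefM; case: n => [|n]; first by rewrite big_ord1 /= coefX mul0r.
rewrite big_ord_recl /= coefX mul0r add0r big_ord_recl /= coefX mul1r subSS.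
by rewrite subn0 big1 ?addr0 // => i _; rewrite coefX mul0r.
Qed.

(** The recursion that the equation [f * g = 1] imposes on the coefficients of
    [g] when [f] has constant coefficient 1; the list holds them in decreasing
    order of the exponents. *)
Fixpoint fps_inv_seq f n : seq R :=
  if n is m.+1 then
    let s := fps_inv_seq f m in
    ((m == 0)%:R - \sum_(i < m) fcoef f i.+1 * s`_i) :: s
  else [::].

Definition fps_inv f : fps R := Fps (fun n => head 0 (fps_inv_seq f n.+1)).

Lemma fps_inv_seqE f n i : (i < n)%N ->
  (fps_inv_seq f n)`_i = fcoef (fps_inv f) (n.-1 - i).
Proof.
elim: n i => // n IH [|i] lt_in; first by rewrite subn0.
by rewrite [LHS]IH //; congr fcoef; lia.
Qed.

Lemma fps_invE f n : fcoef (fps_inv f) n =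
  (n == 0)%:R - \sum_(i < n) fcoef f i.+1 * fcoef (fps_inv f) (n.-1 - i).
Proof.
rewrite [LHS]/=; congr (_ - _); apply: eq_bigr => i _.
by rewrite fps_inv_seqE.
Qed.

Lemma fps_mulV f : fcoef f 0 = 1 -> f * fps_inv f = 1.
Proof.
move=> f0; apply/fpsP => n; rewrite fcoefM big_ord_recl f0 mul1r subn0.
rewrite fps_invE fcoef1 addrAC; apply/eqP; rewrite subr_eq; apply/eqP.
congr (_ + _); apply: eq_bigr => i _; congr (_ * fcoef _ _).
by rewrite lift0; lia.
Qed.

End FpsRing.

(** * Series with nonnegative coefficients and clique polynomials *)

Section FpsNonneg.
Variable R : numDomainType.
Implicit Types f g : fps R.

Definition fps_nonneg f := forall n, 0 <= fcoef f n.

Lemma fps_nonneg1 : fps_nonneg 1.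
Proof. by move=> n; rewrite fcoef1 ler0n. Qed.

Lemma fps_nonnegX : fps_nonneg (fpsX R).
Proof. by move=> n; rewrite /= coefX ler0n. Qed.

Lemma fps_nonnegD f g : fps_nonneg f -> fps_nonneg g -> fps_nonneg (f + g).
Proof. by move=> f0 g0 n; rewrite fcoefD addr_ge0. Qed.

Lemma fps_nonnegM f g : fps_nonneg f -> fps_nonneg g -> fps_nonneg (f * g).
Proof.
by move=> f0 g0 n; rewrite fcoefM sumr_ge0 // => i _; rewrite mulr_ge0.
Qed.

(** The series [h / (1 - f)] has nonnegative coefficients; they are obtained
    from the fixed point equation, without summing powers of [f]. *)
Lemma fps_nonneg_geometric f g h : fps_nonneg f -> fps_nonneg h ->
  fcoef f 0 = 0 -> g = h + f * g -> fps_nonneg g.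
Proof.
move=> f_ge0 h_ge0 f0 gE; elim/ltn_ind => n IH.
rewrite gE fcoefD fcoefM big_ord_recl f0 mul0r add0r.
rewrite addr_ge0 // sumr_ge0 // => i _.
by rewrite mulr_ge0 // IH // lift0; have := ltn_ord i; lia.
Qed.

End FpsNonneg.

Section CliquePolynomial.
Variables (V : finType) (e : rel V).
Hypothesis e_sym : symmetric e.
Implicit Types (v : V) (U L K : {set V}).

Definition clique K := [forall u in K, forall v in K, (u != v) ==> e u v].

Lemma cliqueP K :
  reflect {in K &, forall u v, u != v -> e u v} (clique K).
Proof.
apply: (iffP forall_inP) => [H u v uK vK uv|H u uK].
  by have /forall_inP/(_ v vK)/implyP := H u uK; exact.
by apply/forall_inP => v vK; apply/implyP; exact: H.
Qed.

Definition nbr v U := U :&: [set u | e v u].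

Lemma clique_setU1 v K : v \notin K ->
  clique (v |: K) = clique K && (K \subset [set u | e v u]).
Proof.
move=> vK; apply/cliqueP/andP => [H|[/cliqueP H /subsetP sK] x y].
  split; first by apply/cliqueP => x y xK yK; apply: H; rewrite inE ?xK ?yK orbT.
  apply/subsetP => x xK; rewrite inE; apply: H; rewrite ?inE ?eqxx ?xK ?orbT //.
  by apply: contraNneq vK => ->.
rewrite !inE => /orP[/eqP ->|xK] /orP[/eqP ->|yK]; rewrite ?eqxx //.
- by move=> _; have := sK _ yK; rewrite inE.
- by move=> _; have := sK _ xK; rewrite inE e_sym.
- exact: H.
Qed.

(** The generating polynomial of the cliques of [U], evaluated at
    [- 2 X / (1 + X)] and multiplied by [(1 + X) ^+ #|U|] to clear
    denominators. *)
Definition clique_poly U : {poly int} :=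
  \sum_(K : {set V} | clique K && (K \subset U))
     (- 2 * 'X) ^+ #|K| * (1 + 'X) ^+ (#|U| - #|K|).

Lemma clique0 : clique set0.
Proof. by apply/cliqueP => x y /[!in_set0]. Qed.

Lemma clique_poly0 : clique_poly set0 = 1.
Proof.
rewrite /clique_poly (big_pred1 set0) ?cards0 ?expr0 ?mul1r // => K.
by rewrite subset0 andbC /pred1 /=; case: eqP => [->|//]; rewrite clique0.
Qed.

(** The cliques of [v |: U] that contain [v] are the cliques of the
    neighbourhood of [v] in [U], with [v] added. *)
Lemma clique_poly_setU1 v U : v \notin U ->
  clique_poly (v |: U) = (1 + 'X) * clique_poly U -
    2 * 'X * (1 + 'X) ^+ (#|U| - #|nbr v U|) * clique_poly (nbr v U).
Proof.
move=> vU; rewrite /clique_poly (bigID (fun K : {set V} => v \in K)) /= addrC.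
rewrite -mulNr; congr (_ + _); rewrite big_distrr /=.
  apply: eq_big => K.
    rewrite -andbA; congr (_ && _); apply/andP/idP => [[/subsetP KU vK]|KU].
      apply/subsetP => x xK; have := KU _ xK; rewrite !inE.
      by case: eqP => // xv; move: vK; rewrite -xv xK.
    split; first exact: subset_trans KU (subsetUr _ _).
    by apply: contraNN vU; exact: (subsetP KU).
  move=> /andP[/andP[_ KU] vK]; rewrite mulrCA -exprS; congr (_ * _ ^+ _).
  rewrite cardsU1 vU subSn // subset_leq_card //.
  apply/subsetP => x xK; have := subsetP KU _ xK; rewrite !inE.
  by case: eqP => // xv; move: vK; rewrite -xv xK.
rewrite (reindex_onto (fun K : {set V} => v |: K) (fun K => K :\ v)) /=; last first.
  by move=> K /andP[_ vK]; rewrite setD1K.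
rewrite (eq_bigl (fun K => clique K && (K \subset nbr v U))) => [|K]; last first.
  rewrite setU11 andbT; case: (boolP (v \in K)) => vK.
    rewrite [RHS]andbC [K \subset _](_ : _ = false) /=; last first.
      by apply/negP => /subsetP/(_ v vK); rewrite !inE (negbTE vU).
    apply/negP => /andP[_ /eqP vKK].
    by move: vK; rewrite -vKK !inE eqxx.
  rewrite setU1K // eqxx andbT clique_setU1 // -andbA; congr (_ && _).
  rewrite subsetI andbC; congr (_ && _).
  rewrite subUset sub1set setU11 /=; apply/idP/idP => [/subsetP KU|KU].
    apply/subsetP => x xK; have := KU _ xK; rewrite !inE.
    by case: eqP => // xv; move: vK; rewrite -xv xK.
  exact: subset_trans KU (subsetUr _ _).
apply: eq_bigr => K /andP[_ KL].
have vK : v \notin K by apply: contraNN vU => /(subsetP KL); rewrite inE => /andP[].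
have := subset_leq_card KL; have := subset_leq_card (subsetIl U [set u | e v u]).
rewrite -/(nbr v U) !cardsU1 vU vK => LU KL'.
rewrite (_ : _ - _ = (#|U| - #|nbr v U|) + (#|nbr v U| - #|K|))%N; last by lia.
rewrite add1n exprS exprD; ring.
Qed.

Definition series_of U : fps int := fps_of_poly (clique_poly U).
Definition inv_series U : fps int := fps_inv (series_of U).

Lemma clique_poly_coef0 U : (clique_poly U)`_0 = 1.
Proof.
rewrite -horner_coef0 /clique_poly horner_sum (bigD1 set0) /=; last first.
  by rewrite sub0set clique0.
rewrite cards0 big1 ?addr0 => [|K /andP[_ K0]].
  by rewrite !hornerE /= expr1n.
have [k ->] : exists k, #|K| = k.+1.
  by exists #|K|.-1; rewrite prednK // card_gt0.
by rewrite exprS !hornerM hornerX !(mulr0, mul0r).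
Qed.

Lemma series_ofV U : series_of U * inv_series U = 1.
Proof. by rewrite fps_mulV //= clique_poly_coef0. Qed.

Notation X := (fpsX int).

Lemma series_of_setU1 v U : v \notin U ->
  series_of (v |: U) = (1 + X) * series_of U -
    2 * X * (1 + X) ^+ (#|U| - #|nbr v U|) * series_of (nbr v U).
Proof.
move=> vU; rewrite /series_of clique_poly_setU1 //.
by rewrite !(rmorphB, rmorphM, rmorphD, rmorphXn, rmorph1, rmorph_nat) /=.
Qed.

(** The growth series of the shortest representatives of the cosets, in the
    group of [U], of the subgroup generated by [L]. *)
Definition coset_series L U : fps int :=
  (1 + X) ^+ (#|U| - #|L|) * series_of L * inv_series U.

(** The quotient of the clique polynomials of [v |: U] and [U] is
    [1 - deletion_series v U]; this form shows the signs of the coefficients. *)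
Definition deletion_series v U : fps int :=
  X + 2 * X * (coset_series (nbr v U) U - 1).

Lemma deletion_seriesE v U : v \notin U ->
  series_of (v |: U) = series_of U * (1 - deletion_series v U).
Proof.
move=> vU; rewrite series_of_setU1 // /deletion_series /coset_series.
set P := (1 + X) ^+ _; set D := series_of U; set L := series_of _.
have DV : D * inv_series U = 1 by exact: series_ofV.
have -> : 2 * X * P * L = 2 * X * P * L * (D * inv_series U) by rewrite DV mulr1.
ring.
Qed.

Lemma inv_series_setU1 v U : v \notin U ->
  inv_series (v |: U) = inv_series U + deletion_series v U * inv_series (v |: U).
Proof.
move=> vU; have DV := series_ofV U; have DV' := series_ofV (v |: U).
have := deletion_seriesE vU.
set D := series_of U in DV *; set D' := series_of _ in DV' *.
set W := inv_series U in DV *; set W' := inv_series _ in DV' *.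
set B := deletion_series v U => D'E.
have -> : W' = (D * W) * W' by rewrite DV mul1r.
have -> : B * (D * W * W') = W * (D * W' - D' * W') by rewrite D'E; ring.
rewrite DV'; ring.
Qed.

Lemma coset_series_coef0 L U : fcoef (coset_series L U) 0 = 1.
Proof.
have E0 W : fcoef (series_of W) 0 = 1 by exact: clique_poly_coef0.
have iE : fcoef (inv_series U) 0 = 1.
  have /fpsP/(_ 0) := series_ofV U.
  by rewrite fcoefM0 fcoef1 E0 mul1r.
rewrite /coset_series !fcoefM0 iE E0 !mulr1.
have : fcoef (1 + X) 0 = 1 by rewrite fcoefD fcoef1 /= coefX addr0.
move: (1 + X) => Y Y0; elim: (_ - _)%N => [|n IH] //.
by rewrite exprS fcoefM0 Y0 IH.
Qed.

Lemma deletion_series_nonneg_of v U : fps_nonneg (coset_series (nbr v U) U) ->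
  fps_nonneg (deletion_series v U).
Proof.
move=> C_ge0; apply: fps_nonnegD; first exact: fps_nonnegX.
apply: fps_nonnegM.
  by rewrite mulr_natl mulr2n; apply: fps_nonnegD; exact: fps_nonnegX.
by case=> [|n]; rewrite fcoefB fcoef1 ?coset_series_coef0 ?subrr ?subr0.
Qed.

Lemma deletion_series_coef0 v U : fcoef (deletion_series v U) 0 = 0.
Proof. by rewrite /deletion_series (mulrC 2) -mulrA fcoefD fcoefXM /= coefX. Qed.

Lemma deletion_series_coef1 v U : fcoef (deletion_series v U) 1 = 1.
Proof.
rewrite /deletion_series (mulrC 2) -mulrA fcoefD fcoefXM fcoefM0 fcoefB fcoef1.
by rewrite coset_series_coef0 subrr mulr0 addr0 /= coefX.
Qed.

(** Deleting a vertex [v] outside [L] factors the quotient as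
    [coset_series L (U :\ v) * ((1 + X) / (1 - deletion_series v (U :\ v)))];
    the second factor only involves [coset_series] for a smaller graph. *)
Lemma coset_series_nonneg L U : L \subset U -> fps_nonneg (coset_series L U).
Proof.
move: {2}#|U| (leqnn #|U|) => n; elim: n => [|n IH] in L U *; move=> Un LU.
  have U0 : U = set0 by apply/eqP; rewrite -cards_eq0 -leqn0.
  move: LU; rewrite U0 subset0 => /eqP ->.
  by rewrite /coset_series subnn mul1r series_ofV; exact: fps_nonneg1.
have [<-|UL] := eqVneq L U.
  by rewrite /coset_series subnn mul1r series_ofV; exact: fps_nonneg1.
have /properP[_ [v vU vL]] : L \proper U by rewrite properEneq UL.
set U' := U :\ v.
have vU' : v \notin U' by rewrite !inE eqxx.
have UE : U = v |: U' by rewrite setD1K.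
have U'n : (#|U'| <= n)%N by move: Un; rewrite (cardsD1 v U) vU.
have LU' : L \subset U' by rewrite subsetD1 LU vL.
have B_ge0 : fps_nonneg (deletion_series v U').
  by apply: deletion_series_nonneg_of; apply: IH => //; exact: subsetIl.
pose G := series_of U' * inv_series U.
have G_ge0 : fps_nonneg G.
  apply: (fps_nonneg_geometric B_ge0 (@fps_nonneg1 _)).
    exact: deletion_series_coef0.
  rewrite /G {1}UE (inv_series_setU1 vU') mulrDr series_ofV -UE; ring.
have -> : coset_series L U = coset_series L U' * (1 + X) * G.
  rewrite /coset_series /G.
  have -> : (#|U| - #|L| = (#|U'| - #|L|).+1)%N.
    by rewrite UE cardsU1 vU' add1n subSn // subset_leq_card.
  rewrite exprS.
  transitivity ((1 + X) * (1 + X) ^+ (#|U'| - #|L|) * series_of L *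
    (series_of U' * inv_series U') * inv_series U); last by ring.
  by rewrite series_ofV mulr1.
apply: fps_nonnegM => //; apply: fps_nonnegM; first exact: IH.
by apply: fps_nonnegD; [exact: fps_nonneg1|exact: fps_nonnegX].
Qed.

Lemma deletion_series_nonneg v U : fps_nonneg (deletion_series v U).
Proof.
by apply: deletion_series_nonneg_of; apply: coset_series_nonneg; exact: subsetIl.
Qed.

Lemma set_ind (P : {set V} -> Prop) : P set0 ->
  (forall v U, v \notin U -> P U -> P (v |: U)) -> forall U, P U.
Proof.
move=> P0 PS U; move: {2}#|U| (erefl #|U|) => n; elim: n U => [|n IH] U Un.
  by rewrite (cards0_eq Un).
have /card_gt0P[v vU] : (0 < #|U|)%N by rewrite Un.
rewrite -(setD1K vU); apply: PS; first by rewrite !inE eqxx.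
by apply: IH; move: Un; rewrite (cardsD1 v) vU => -[].
Qed.

Lemma series_of0 : series_of set0 = 1.
Proof. by rewrite /series_of clique_poly0 rmorph1. Qed.

Lemma inv_series0 : inv_series set0 = 1.
Proof. by have := series_ofV set0; rewrite series_of0 mul1r. Qed.

Lemma inv_series_nonneg U : fps_nonneg (inv_series U).
Proof.
elim/set_ind: U => [|v U vU IH]; first by rewrite inv_series0; exact: fps_nonneg1.
apply: fps_nonneg_geometric (deletion_series_nonneg v U) IH _ _.
  exact: deletion_series_coef0.
exact: inv_series_setU1.
Qed.

End CliquePolynomial.

(** * Evaluation of partial sums *)

Section PartialSums.
Variable F : comNzRingType.
Implicit Types (f : fps int) (p q : {poly int}) (x : F).

Definition psum f n x : F := \sum_(i < n) (fcoef f i)%:~R * x ^+ i.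

Definition evalz p x : F := (map_poly intr p).[x].

Lemma evalzE p x n : (size p <= n)%N ->
  evalz p x = \sum_(i < n) (p`_i)%:~R * x ^+ i.
Proof.
move=> pn; rewrite /evalz (@horner_coef_wide _ n).
  by apply: eq_bigr => i _; rewrite coef_map.
exact: leq_trans (size_poly _ _) pn.
Qed.

Lemma psum_poly p n x : (size p <= n)%N -> psum (fps_of_poly p) n x = evalz p x.
Proof. by move=> pn; rewrite (evalzE x pn). Qed.

Lemma psum_trunc f n x : psum f n x = evalz (fps_trunc n f) x.
Proof.
rewrite (@evalzE _ _ n) ?size_poly //.
by apply: eq_bigr => i _; rewrite coef_poly ltn_ord.
Qed.

Lemma psumS f n x : psum f n.+1 x = psum f n x + (fcoef f n)%:~R * x ^+ n.
Proof. by rewrite /psum big_ord_recr. Qed.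

Lemma psum1 f x : psum f 1 x = (fcoef f 0)%:~R.
Proof. by rewrite /psum big_ord1 mulr1. Qed.

Lemma psumD f g n x : psum (f + g) n x = psum f n x + psum g n x.
Proof.
rewrite /psum -big_split; apply: eq_bigr => i _ /=.
by rewrite rmorphD mulrDl.
Qed.

Lemma psumM f g n x : psum (f * g) n x =
  \sum_(j < n) (fcoef f j)%:~R * x ^+ j * psum g (n - j) x.
Proof.
elim: n => [|n IH]; first by rewrite /psum !big_ord0.
rewrite psumS IH fcoefM [in RHS]big_ord_recr /= subSnn.
have -> : \sum_(i < n) (fcoef f i)%:~R * x ^+ i * psum g (n.+1 - i) x =
   \sum_(j < n) (fcoef f j)%:~R * x ^+ j * psum g (n - j) x +
   \sum_(j < n) (fcoef f j)%:~R * (fcoef g (n - j))%:~R * x ^+ n.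
  rewrite -big_split; apply: eq_bigr => i _ /=.
  rewrite subSn 1?ltnW // psumS mulrDr; congr (_ + _).
  by rewrite mulrACA -exprD subnKC // ltnW.
rewrite -addrA; congr (_ + _); rewrite big_ord_recr /= subnn.
rewrite rmorphD rmorph_sum mulrDl mulr_suml; congr (_ + _).
  by apply: eq_bigr => i _; rewrite rmorphM.
by rewrite rmorphM mulrAC psum1.
Qed.

End PartialSums.

Section PartialSumBounds.
Variable F : numDomainType.
Implicit Types (f g : fps int) (p q : {poly int}) (r s t : F).

Lemma psum_term_ge0 f r i : fps_nonneg f -> 0 <= r ->
  0 <= (fcoef f i)%:~R * r ^+ i.
Proof. by move=> f0 r0; rewrite mulr_ge0 ?ler0z ?exprn_ge0. Qed.

Lemma psum_ge0 f n r : fps_nonneg f -> 0 <= r -> 0 <= psum f n r.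
Proof. by move=> f0 r0; apply: sumr_ge0 => i _; exact: psum_term_ge0. Qed.

Lemma psum_tailE f m n t : (m <= n)%N ->
  psum f n t - psum f m t = \sum_(m <= i < n) (fcoef f i)%:~R * t ^+ i.
Proof.
move=> mn; rewrite /psum -(big_mkord xpredT (fun i => (fcoef f i)%:~R * t ^+ i)).
rewrite -(big_mkord xpredT (fun i => (fcoef f i)%:~R * t ^+ i)).
by rewrite (big_cat_nat (leq0n m) mn) /= addrAC subrr add0r.
Qed.

Lemma psum_nd f r m n : fps_nonneg f -> 0 <= r -> (m <= n)%N ->
  psum f m r <= psum f n r.
Proof.
move=> f0 r0 mn; rewrite -subr_ge0 psum_tailE //.
by apply: sumr_ge0 => i _; exact: psum_term_ge0.
Qed.

Lemma psum_le f n r s : fps_nonneg f -> 0 <= r -> r <= s ->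
  psum f n r <= psum f n s.
Proof.
move=> f0 r0 rs; apply: ler_sum => i _.
by rewrite ler_wpM2l ?ler0z // lerXn2r // nnegrE (le_trans r0).
Qed.

(** As [f] has no constant term, scaling the variable by [s] scales every
    monomial by at most [s]. *)
Lemma psum_scale f n r s : fps_nonneg f -> fcoef f 0 = 0 -> 0 <= r ->
  0 <= s <= 1 -> psum f n (s * r) <= s * psum f n r.
Proof.
move=> f0 f00 r0 /andP[s0 s1]; rewrite mulr_sumr; apply: ler_sum => -[[|i] _] _ /=.
  by rewrite f00 !mul0r mulr0.
rewrite exprMn mulrCA ler_wpM2r ?psum_term_ge0 //.
by rewrite exprS ler_piMr ?exprn_ile1.
Qed.

Lemma psum_tail_norm f m n t : fps_nonneg f -> (m <= n)%N ->
  `|psum f n t - psum f m t| <= psum f n `|t| - psum f m `|t|.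
Proof.
move=> f0 mn; rewrite !psum_tailE //; apply: le_trans (ler_norm_sum _ _ _) _.
by apply: ler_sum => i _; rewrite normrM normrX ger0_norm ?ler0z.
Qed.

Lemma psumM_le f g n r : fps_nonneg f -> fps_nonneg g -> 0 <= r ->
  psum (f * g) n r <= psum f n r * psum g n r.
Proof.
move=> f0 g0 r0; rewrite psumM mulr_suml; apply: ler_sum => j _.
by rewrite ler_wpM2l ?psum_term_ge0 // psum_nd // leq_subr.
Qed.

Definition abs_evalz p r : F := \sum_(j < size p) `|(p`_j)%:~R| * r ^+ j.

Lemma abs_evalz_ge0 p r : 0 <= r -> 0 <= abs_evalz p r.
Proof. by move=> r0; apply: sumr_ge0 => j _; rewrite mulr_ge0 ?exprn_ge0. Qed.

Lemma psum_polyM p f n t : psum (fps_of_poly p * f) n t =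
  \sum_(j < size p) (p`_j)%:~R * t ^+ j * psum f (n - j) t.
Proof.
rewrite psumM /=; have [pn|np] := leqP (size p) n.
  rewrite [RHS](big_ord_widen n (fun j => (p`_j)%:~R * t ^+ j * psum f (n - j) t)) //.
  rewrite [RHS]big_mkcond; apply: eq_bigr => j _; case: ltnP => // pj.
  by rewrite nth_default // !mul0r.
rewrite (big_ord_widen (size p) (fun j => (p`_j)%:~R * t ^+ j * psum f (n - j) t)) 1?ltnW //.
rewrite big_mkcond; apply: eq_bigr => j _; case: ltnP => // nj.
by rewrite (_ : n - j = 0)%N ?[psum f 0 t]/psum ?big_ord0 ?mulr0 //; lia.
Qed.

Lemma psum_polyM_norm p f n t : fps_nonneg f ->
  `|psum (fps_of_poly p * f) n t| <= abs_evalz p `|t| * psum f n `|t|.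
Proof.
move=> f0; rewrite psum_polyM mulr_suml; apply: le_trans (ler_norm_sum _ _ _) _.
apply: ler_sum => j _; rewrite !normrM normrX ler_wpM2l ?mulr_ge0 ?exprn_ge0 //.
apply: le_trans (psum_nd f0 (normr_ge0 t) (leq_subr j n)).
by have := psum_tail_norm t f0 (leq0n (n - j)); rewrite /psum !big_ord0 !subr0.
Qed.

(** The failure of evaluation to commute with a product by a polynomial is
    controlled by the last [size p] terms of the partial sum. *)
Lemma evalz_psum_error p q f n t : fps_nonneg f ->
  fps_of_poly p * f = fps_of_poly q -> (size q <= n)%N ->
  `|evalz p t * psum f n t - evalz q t| <=
    abs_evalz p `|t| * (psum f n `|t| - psum f (n - size p) `|t|).
Proof.
move=> f0 pfq qn; rewrite -(psum_poly t qn) -pfq psum_polyM.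
rewrite (evalzE t (leqnn _)) mulr_suml -sumrB mulr_suml.
apply: le_trans (ler_norm_sum _ _ _) _; apply: ler_sum => j _.
rewrite -mulrBr !normrM normrX ler_wpM2l ?mulr_ge0 ?exprn_ge0 //.
apply: le_trans (psum_tail_norm _ f0 (leq_subr _ _)) _.
by rewrite lerD2l lerN2 psum_nd // leq_sub2l // ltnW.
Qed.

End PartialSumBounds.

(** * Sums of nonnegative series *)

Section Convergence.
Variable R : realType.
Implicit Types (f g : fps int) (p q : {poly int}) (r s : R) (t : R[i]).

Definition converges f r := exists M : R, forall n, psum f n r <= M.

(** The partial sums of a nonnegative series increase, so that [L] is their
    limit as soon as it is an upper bound that they approach. *)
Definition sums_to f r (L : R) := (forall n, psum f n r <= L) /\
  forall eps, 0 < eps -> exists N, forall n, (N <= n)%N -> L - eps < psum f n r.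

Lemma converges_sum f r : fps_nonneg f -> 0 <= r -> converges f r ->
  exists L, sums_to f r L.
Proof.
move=> f0 r0 [M fM]; pose E := range (fun n => psum f n r).
have supE : has_sup E.
  split; first by exists (psum f 0 r), 0%N.
  by exists M => _ [n _ <-].
exists (sup E); split=> [n|eps eps0].
  by apply: ub_le_sup; [exact: supE.2|exists n].
have [_ [N _ <-] LN] := sup_adherent eps0 supE; exists N => n Nn.
exact: lt_le_trans LN (psum_nd f0 r0 Nn).
Qed.

Lemma sum_le f r L M : sums_to f r L -> (forall n, psum f n r <= M) -> L <= M.
Proof.
move=> [_ fL] fM; rewrite leNgt; apply/negP => ML.
have [N /(_ N (leqnn N))] := fL (L - M) (ltac:(by rewrite subr_gt0)).
by rewrite subKr ltNge fM.
Qed.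

Lemma psum_realC f n r : psum f n r%:C = (psum f n r)%:C.
Proof.
rewrite /psum rmorph_sum; apply: eq_bigr => i _.
by rewrite rmorphM rmorphXn rmorph_int.
Qed.

Lemma evalz_realC p r : evalz p r%:C = (evalz p r)%:C.
Proof.
rewrite !(evalzE _ (leqnn _)) rmorph_sum; apply: eq_bigr => i _.
by rewrite rmorphM rmorphXn rmorph_int.
Qed.

Lemma abs_evalz_realC p r : abs_evalz p r%:C = (abs_evalz p r)%:C.
Proof.
rewrite /abs_evalz rmorph_sum; apply: eq_bigr => i _.
by rewrite rmorphM rmorphXn !normrMz !normr1 !rmorph_int.
Qed.

Lemma psum_cauchy f r d eps : fps_nonneg f -> 0 <= r -> converges f r ->
  0 < eps -> exists N, forall n, (N <= n)%N ->
    psum f n r - psum f (n - d) r < eps.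
Proof.
move=> f0 r0 fr eps0; have [L [fL Lf]] := converges_sum f0 r0 fr.
have [N LN] := Lf _ eps0; exists (N + d)%N => n Nn.
have := LN (n - d)%N ltac:(lia); have := fL n; lra.
Qed.

(** Complex arguments only enter through this estimate: its error term is a
    real sequence, so that no complex limit is needed. *)
Lemma evalz_psum_cvg p q f t r eps : fps_nonneg f ->
  fps_of_poly p * f = fps_of_poly q -> `|t| = r%:C -> converges f r ->
  0 < eps -> exists N, forall n, (N <= n)%N ->
    `|evalz p t * psum f n t - evalz q t| <= eps%:C.
Proof.
move=> f0 pfq tr fr eps0.
have r0 : 0 <= r by rewrite -lecR -tr normr_ge0.
have A0 := abs_evalz_ge0 p r0.
have e0 : 0 < eps / (abs_evalz p r + 1) by rewrite divr_gt0 //; lra.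
have [N HN] := psum_cauchy (size p) f0 r0 fr e0.
exists (N + size q)%N => n Nn.
apply: le_trans (evalz_psum_error t f0 pfq _) _; first by lia.
rewrite tr abs_evalz_realC !psum_realC -rmorphB -rmorphM lecR.
have /ltW := HN n ltac:(lia); rewrite ler_pdivlMr; last by lra.
have := psum_nd f0 r0 (leq_subr (size p) n).
by nra.
Qed.

Lemma evalz_sum p q f r L : fps_nonneg f -> 0 <= r ->
  fps_of_poly p * f = fps_of_poly q -> sums_to f r L ->
  evalz p r * L = evalz q r.
Proof.
move=> f0 r0 pfq [fL Lf]; apply/eqP; rewrite -subr_eq0 -normr_le0.
apply/ler_addgt0Pr => eps eps0; rewrite add0r.
have tr : `|r%:C| = r%:C by rewrite ger0_norm ?lecR.
have e2 : 0 < eps / 2 by lra.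
have [N HN] := evalz_psum_cvg f0 pfq tr (ex_intro _ L fL) e2.
pose e' := eps / 2 / (`|evalz p r| + 1).
have e'0 : 0 < e' by rewrite divr_gt0 // ltr_wpDl.
have [N' HN'] := Lf _ e'0.
pose n := (N + N')%N.
have := HN n (leq_addr _ _); rewrite psum_realC !evalz_realC -rmorphM -rmorphB.
rewrite (_ : `|_%:C| = `|evalz p r * psum f n r - evalz q r|%:C); last first.
  by rewrite normc_def /= expr0n addr0 sqrtr_sqr.
rewrite lecR => H1; have H2 := HN' n (leq_addl _ _); have H3 := fL n.
have -> : evalz p r * L - evalz q r = (evalz p r * psum f n r - evalz q r) +
   evalz p r * (L - psum f n r) by ring.
apply: le_trans (ler_normD _ _) _; rewrite [leRHS](splitr eps) lerD //.
rewrite normrM (ger0_norm (x := L - _)) ?subr_ge0 //.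
have : L - psum f n r <= e' by lra.
rewrite ler_pdivlMr ?ltr_wpDl // => H4.
have := normr_ge0 (evalz p r); nra.
Qed.

Lemma converges_le f r s : fps_nonneg f -> 0 <= r -> r <= s ->
  converges f s -> converges f r.
Proof.
move=> f0 r0 rs [M fM]; exists M => n.
exact: le_trans (psum_le n f0 r0 rs) (fM n).
Qed.

Lemma converges_polyM p f g r : fps_nonneg f -> 0 <= r ->
  g = fps_of_poly p * f -> converges f r -> converges g r.
Proof.
move=> f0 r0 -> [M fM]; exists (abs_evalz p r * M) => n.
apply: le_trans (ler_norm _) _.
have := psum_polyM_norm p n r f0; rewrite (ger0_norm r0) => /le_trans; apply.
by rewrite ler_wpM2l ?abs_evalz_ge0.
Qed.

End Convergence.

(** * The dominant root after one vertex deletion *)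

(** The hypothesis is equality in the triangle inequality for the sum
    [(1 - t) + t], so that [t] and [1 - t] have the same argument as 1. *)
Lemma norm_sub1_real (C : numClosedFieldType) (t : C) :
  `|1 - t| + `|t| <= 1 -> t = `|t|.
Proof.
move=> le1; have E : `|1 - t + t| = `|1 - t| + `|t|.
  apply/le_anti; rewrite ler_normD /=.
  by rewrite subrK normr1.
have [u _ [tE1 tE2]] := normCDeq E.
have u1 : u = 1.
  move: E; rewrite subrK normr1 => E.
  by rewrite -[u]mul1r E mulrDl -tE1 -tE2 subrK.
by rewrite {1}tE2 u1 mulr1.
Qed.

Lemma norm_realC (R : rcfType) (z : R[i]) : exists r, `|z| = r%:C.
Proof. by rewrite normc_def; eexists. Qed.

Lemma evalzB (F : comNzRingType) (p q : {poly int}) (x : F) :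
  evalz (p - q) x = evalz p x - evalz q x.
Proof. by rewrite /evalz rmorphB hornerD hornerN. Qed.

Section DominantRoot.
Variable R : realType.
Implicit Types (f g W B : fps int) (p q D : {poly int}) (r s : R) (t : R[i]).

(** The series [W] is meant to be the inverse of [D]. *)
Definition dominant_root D W rho :=
  [/\ 0 < rho, forall r, 0 <= r < rho -> converges W r &
      forall t, evalz D t = 0 -> `|t| <= rho%:C -> t = rho%:C].

(** The situation of one vertex deletion: [D] and [D'] stand for the clique
    polynomials with and without the vertex, [W] and [W'] for their inverses.
    The alternative [1 < rho'] is for [D' = 1], which has no root. *)
Variables (D D' : {poly int}) (W W' B : fps int) (rho' : R).
Hypotheses (W_ge0 : fps_nonneg W) (W'_ge0 : fps_nonneg W').
Hypotheses (B_ge0 : fps_nonneg B) (B0 : fcoef B 0 = 0) (B1 : fcoef B 1 = 1).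
Hypothesis DE : fps_of_poly D = fps_of_poly D' * (1 - B).
Hypothesis W'E : fps_of_poly D' * W' = 1.
Hypothesis WE : W = W' + B * W.
Hypothesis D'_dom : dominant_root D' W' rho'.
Hypothesis D'_root : evalz D' rho' = 0 \/ 1 < rho'.

Let rho'0 : 0 < rho'. Proof. by case: D'_dom. Qed.

Let mulD'B : fps_of_poly D' * B = fps_of_poly (D' - D).
Proof. rewrite rmorphB /= DE; ring. Qed.

Lemma converges_B r : 0 <= r < rho' -> converges B r.
Proof.
move=> /andP[r0 rr]; have [_ /(_ r)] := D'_dom; rewrite r0 rr => /(_ isT) Wr _.
apply: (converges_polyM (p := D' - D) W'_ge0 r0 _ Wr).
by rewrite -mulD'B mulrAC W'E mul1r.
Qed.

Definition unit_radii := [set r | 0 <= r <= rho' /\ forall n, psum B n r <= 1]%classic.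

(** The radius at which the sum of [B] reaches 1, or [rho'] if the sum stays
    below 1 up to there. *)
Definition critical_radius := sup unit_radii.

Local Notation rho := critical_radius.

Let has_sup_unit_radii : has_sup unit_radii.
Proof.
split; last by exists rho' => r [/andP[]].
exists 0; split; first by rewrite lexx ltW.
move=> n; rewrite /psum; apply: le_trans ler01.
rewrite big1 // => -[[|i] _] _ /=; first by rewrite B0 mul0r.
by rewrite exprS mul0r mulr0.
Qed.

Lemma critical_radius_ge r : unit_radii r -> r <= rho.
Proof. by move=> Ar; apply: ub_le_sup => //; exact: has_sup_unit_radii.2. Qed.

(** The sum of [B] is small near 0, because [B] has no constant term. *)
Lemma critical_radius_gt0 : 0 < rho.
Proof.
pose r1 := rho' / 2; have r10 : 0 < r1 by rewrite divr_gt0.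
have r1' : r1 < rho' by rewrite /r1; have := rho'0; lra.
have [|M BM] := @converges_B r1; first by rewrite ltW.
pose M' := `|M| + 1; have M'0 : 0 < M' by rewrite ltr_wpDl.
have M'1 : 1 <= M' by rewrite /M' lerDr.
suff A : unit_radii (M'^-1 * r1).
  by apply: lt_le_trans (critical_radius_ge A); rewrite mulr_gt0 // invr_gt0.
have M'i : 0 <= M'^-1 <= 1 by rewrite invr_ge0 ltW //= invf_le1.
split.
  case/andP: M'i => M'i0 M'i1; apply/andP; split.
    by rewrite mulr_ge0 // ltW.
  by apply: le_trans (ltW r1'); rewrite ler_piMl // ltW.
move=> n; apply: le_trans (psum_scale n B_ge0 B0 (ltW r10) M'i) _.
rewrite mulrC ler_pdivrMr // mul1r; apply: le_trans (BM n) _.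
by rewrite /M' (le_trans (ler_norm M)) // lerDl.
Qed.

Lemma critical_radius_le : rho <= rho'.
Proof. by apply: ge_sup; [exact: has_sup_unit_radii.1|move=> r [/andP[]]]. Qed.

(** The bound on the partial sums passes to the supremum, because partial sums
    are polynomials. *)
Lemma critical_radius_mem : unit_radii rho.
Proof.
split; first by rewrite ltW ?critical_radius_gt0 ?critical_radius_le.
move=> n; rewrite leNgt; apply/negP => B1lt.
have e0 : 0 < psum B n rho - 1 by rewrite subr_gt0.
have [d d0 cont] := poly_cont rho (map_poly intr (fps_trunc n B)) e0.
have [r Ar rr] := sup_adherent d0 has_sup_unit_radii.
have := cont r; rewrite -!/(evalz _ _) -!psum_trunc => /(_ _)/[!ltr_norml] H.
have rr' := critical_radius_ge Ar.
have {}H := H ltac:(rewrite /critical_radius in rr' *; apply/andP; split; lra).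
by have [_ /(_ n)] := Ar; lra.
Qed.

Lemma critical_radius_le1 : rho <= 1.
Proof.
have [_ /(_ 2)] := critical_radius_mem; rewrite psumS psum1 B0 B1.
by rewrite add0r mul1r expr1.
Qed.

Lemma psum_B_le r n : 0 <= r -> r <= rho -> psum B n r <= r / rho.
Proof.
move=> r0 rrho; have := critical_radius_gt0 => rho0.
rewrite -{1}[r](divfK (lt0r_neq0 rho0)).
have rr : 0 <= r / rho <= 1.
  by rewrite divr_ge0 ?(ltW rho0) //= ler_pdivrMr // mul1r.
apply: le_trans (psum_scale n B_ge0 B0 (ltW rho0) rr) _.
by rewrite ler_piMr ?(andP rr).1 //; case: critical_radius_mem => _; exact.
Qed.

(** At [r] the sum of [B] is at most [r / rho < 1], so that [W = W' + B * W]
    bounds the partial sums of [W] by those of [W']. *)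
Lemma converges_W r : 0 <= r < rho -> converges W r.
Proof.
move=> /andP[r0 rr]; have := critical_radius_gt0 => rho0.
have [M W'M] : converges W' r.
  by case: D'_dom => _ + _; apply; rewrite r0 (lt_le_trans rr critical_radius_le).
exists (M / (1 - r / rho)) => n.
have r1 : r / rho < 1 by rewrite ltr_pdivrMr // mul1r.
rewrite ler_pdivlMr ?subr_gt0 //.
have : psum W n r <= M + r / rho * psum W n r.
  rewrite {1}WE psumD; apply: lerD => //.
  apply: le_trans (psumM_le n B_ge0 W_ge0 r0) _.
  by rewrite ler_wpM2r ?psum_ge0 // psum_B_le // ltW.
lra.
Qed.

(** If [D'] vanishes at [t], then [t = rho' = rho]. Otherwise the sum of [B] at
    [t] is 1. The terms of [B] other than the monomial [X] have absolute values
    at [t] that add up to at most [1 - `|t|]; hence [`|1 - t| <= 1 - `|t|], and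
    [t] is real and nonnegative. On [0, rho] the sum of [B] reaches 1 only at
    [rho]. *)
Lemma root_on_circle t : evalz D t = 0 -> `|t| <= rho%:C -> t = rho%:C.
Proof.
move=> Dt tr; have rho0 := critical_radius_gt0; have [_ Bsum] := critical_radius_mem.
have [_ _ D'_uniq] := D'_dom.
have [D't|D't] := eqVneq (evalz D' t) 0.
  have tE : t = rho'%:C.
    by apply: D'_uniq => //; apply: le_trans tr _; rewrite lecR critical_radius_le.
  suff E : rho' = rho by rewrite tE E.
  apply/le_anti; rewrite critical_radius_le andbT -lecR.
  by move: tr; rewrite tE ger0_norm ?lecR ?(ltW rho'0).
have [r rE] := norm_realC t; have [c cE] := norm_realC (1 - t).
have [a aE] := norm_realC (evalz D' t).
have a0 : 0 < a by rewrite -ltcR -aE normr_gt0.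
have r0 : 0 <= r by rewrite -lecR -rE normr_ge0.
have rrho : r <= rho by rewrite -lecR -rE.
have Bs : converges B r by apply: converges_le r0 rrho _ => //; exists 1.
have cvg eps : 0 < eps -> exists N, forall n, (N <= n)%N ->
    `|evalz D' t| * `|1 - psum B n t| <= eps%:C.
  move=> eps0; have [N HN] := evalz_psum_cvg B_ge0 mulD'B rE Bs eps0.
  exists N => n Nn; rewrite -normrM mulrBr mulr1 distrC.
  by have := HN n Nn; rewrite evalzB Dt subr0.
have tE : t = r%:C.
  rewrite -rE; apply: norm_sub1_real; rewrite rE cE -rmorphD lecR leNgt.
  apply/negP => cr.
  have eps0 : 0 < a * ((c + r - 1) / 2) by rewrite mulr_gt0 // divr_gt0 //; lra.
  have [N /(_ (N + 2)%N (leq_addr _ _))] := cvg _ eps0.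
  have [b bE] := norm_realC (1 - psum B (N + 2) t).
  rewrite aE bE -rmorphM lecR ler_pM2l // => bcr.
  (* The first two terms of [B] contribute [t] itself. *)
  have psum2 (F : numDomainType) (x : F) : psum B 2 x = x.
    by rewrite psumS psum1 B0 B1 add0r mul1r.
  have := psum_tail_norm t B_ge0 (leq_addl N 2).
  rewrite rE !psum2 psum_realC => H.
  have {}H : `|psum B (N + 2) t - t| <= (1 - r)%:C.
    apply: le_trans H _; rewrite -rmorphB lecR lerB //.
    exact: le_trans (psum_le _ B_ge0 r0 rrho) (Bsum _).
  suff : c <= b + (1 - r) by lra.
  rewrite -lecR [(b + _)%:C]rmorphD -cE /= -bE.
  have -> : 1 - t = (1 - psum B (N + 2) t) + (psum B (N + 2) t - t) by ring.
  by apply: le_trans (ler_normD _ _) _; rewrite lerD.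
suff rhor : rho <= r by rewrite tE; congr (real_complex _ _); apply/le_anti/andP.
have [L BL] := converges_sum B_ge0 r0 Bs.
have D'r : evalz D' r != 0 by apply: contra_neq D't; rewrite tE evalz_realC => ->.
have Dr : evalz D r = 0.
  by move: Dt; rewrite tE evalz_realC => /(congr1 (@complex.Re R)).
have L1 : L = 1.
  apply: (mulfI D'r); rewrite (evalz_sum B_ge0 r0 mulD'B BL).
  by rewrite evalzB Dr subr0 mulr1.
have := sum_le BL (fun n => psum_B_le n r0 rrho).
by rewrite L1 ler_pdivlMr // mul1r.
Qed.

(** If [rho = rho'], then [D'] vanishes there and so does [D]. Otherwise a sum of [B] below 1
    at [rho] would make [D' * D] positive at [rho], hence also slightly beyond;
    but it is at most 0 where the sum of [B] exceeds 1. *)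
Lemma critical_radius_root : evalz D rho = 0.
Proof.
have rho0 := critical_radius_gt0; have [_ Bsum] := critical_radius_mem.
have [_ W's D'_uniq] := D'_dom.
have [L BL] := converges_sum B_ge0 (ltW rho0) (ex_intro _ 1 Bsum : converges B rho).
have L_le1 := sum_le BL Bsum.
have DL : evalz D rho = evalz D' rho * (1 - L).
  have := evalz_sum B_ge0 (ltW rho0) mulD'B BL.
  by rewrite evalzB => H; rewrite mulrBr H; ring.
have [rhoE|rho_neq] := eqVneq rho rho'.
  case: D'_root => [D'0|]; first by rewrite DL rhoE D'0 mul0r.
  by rewrite -rhoE ltNge critical_radius_le1.
have rho_lt : rho < rho' by rewrite lt_neqAle rho_neq critical_radius_le.
have D'rho : evalz D' rho != 0.
  apply: contra_neq rho_neq => D'0.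
  have H : rho%:C = rho'%:C.
    apply: D'_uniq; first by rewrite evalz_realC D'0.
    by rewrite ger0_norm ?lecR ?(ltW rho0) ?critical_radius_le.
  exact: complexI H.
apply/eqP; rewrite DL mulf_eq0 (negbTE D'rho) /=; apply: contraT => L1.
(* The factor [D'] spares a discussion of its sign. *)
pose P := map_poly intr (D' * D) : {poly R}.
have PE x : P.[x] = evalz D' x * evalz D x by rewrite /P rmorphM hornerM.
have P0 : 0 < P.[rho].
  rewrite PE DL mulrA -expr2 mulr_gt0 //; first by rewrite exprn_even_gt0.
  by rewrite lt0r L1 subr_ge0.
have [d d0 cont] := poly_cont rho P P0.
pose x := rho + Num.min d (rho' - rho) / 2.
have m0 : 0 < Num.min d (rho' - rho) by rewrite lt_min d0 subr_gt0.
have md : Num.min d (rho' - rho) <= d by rewrite ge_min lexx.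
have mr : Num.min d (rho' - rho) <= rho' - rho by rewrite ge_min lexx orbT.
have rx : rho < x by rewrite /x; lra.
have xr : x < rho' by rewrite /x; lra.
have x0 : 0 < x by lra.
have Px : 0 < P.[x].
  have /cont : `|x - rho| < d by rewrite ger0_norm ?subr_ge0 ?(ltW rx) // /x; lra.
  by rewrite ltr_norml => /andP[+ _]; lra.
have [|L' BL'] := @converges_sum _ B x B_ge0 (ltW x0).
  by apply: converges_B; rewrite xr ltW.
have L'1 : L' <= 1.
  have := evalz_sum B_ge0 (ltW x0) mulD'B BL'; rewrite evalzB => H.
  have DL' : evalz D x = evalz D' x * (1 - L') by rewrite mulrBr H; ring.
  move: Px; rewrite PE DL' mulrA -expr2 => H'.
  rewrite leNgt; apply/negP => L'1; move: H'; apply/negP; rewrite -leNgt.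
  by rewrite mulr_ge0_le0 ?sqr_ge0 // subr_le0 ltW.
have : unit_radii x.
  split; first by rewrite !ltW.
  by move=> n; apply: le_trans L'1; case: BL'.
by move/critical_radius_ge; lra.
Qed.

Lemma dominant_root_critical_radius : dominant_root D W rho.
Proof. by split; [exact: critical_radius_gt0|exact: converges_W|exact: root_on_circle]. Qed.

End DominantRoot.

(** * The dominant root of a clique polynomial *)

Section CliqueDominantRoot.
Variables (R : realType) (V : finType) (e : rel V).
Hypothesis e_sym : symmetric e.

(** The clique polynomial of the empty graph is 1; since no critical radius
    exceeds 1, any number above 1 can take the place of its dominant root. *)
Lemma clique_poly_dominant (U : {set V}) : exists2 rho : R,
  dominant_root (clique_poly e U) (inv_series e U) rho &
  U = set0 /\ 1 < rho \/ evalz (clique_poly e U) rho = 0 /\ rho <= 1.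
Proof.
elim/set_ind: U => [|v U vU [rho' dom rt]].
  exists 2; last by left; split=> //; lra.
  split=> [|r /andP[r0 _]|t]; first by lra.
    exists 1 => n; rewrite inv_series0; case: n => [|n]; first by rewrite /psum big_ord0.
    rewrite -(rmorph1 (@fps_of_poly int)) psum_poly ?size_poly1 //.
    by rewrite /evalz rmorph1 hornerC.
  by rewrite clique_poly0 /evalz rmorph1 hornerC => /eqP; rewrite oner_eq0.
have rt' : evalz (clique_poly e U) rho' = 0 \/ 1 < rho'.
  by case: rt => -[? ?]; [right|left].
have W'0 := inv_series_nonneg e_sym U.
have W0 := inv_series_nonneg e_sym (v |: U).
have B0 := deletion_series_nonneg e_sym v U.
have B00 := deletion_series_coef0 e v U.
have B1 := deletion_series_coef1 e v U.
have DE := deletion_seriesE e_sym vU.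
have WE := inv_series_setU1 e_sym vU.
have DV := series_ofV e U.
exists (critical_radius (deletion_series e v U) rho').
  exact: (dominant_root_critical_radius W0 W'0 B0 B00 B1 DE DV WE dom).
right; split; last exact: (critical_radius_le1 W'0 B0 B00 B1 DE DV dom).
exact: (critical_radius_root W'0 B0 B00 B1 DE DV dom rt').
Qed.

End CliqueDominantRoot.

(** * Normal forms in right-angled Artin groups *)

Section Stacks.
Variables (V : finType) (e : rel V).
Hypothesis e_sym : symmetric e.
Hypothesis e_irr : irreflexive e.

Local Notation letter := (V * bool)%type.
Implicit Types (a b : letter) (w : gword V).

(** The stack at a pair of nonadjacent vertices, possibly equal, lists the
    letters of a word at these vertices; at adjacent pairs it stays empty. *)
Definition stacks := {ffun V * V -> seq letter}.
Implicit Types (f h : stacks).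

Definition touches v (p : V * V) := ((p.1 == v) || (p.2 == v)) && ~~ e p.1 p.2.

Definition push a f : stacks :=
  [ffun p => if touches a.1 p then a :: f p else f p].
Definition pop a f : stacks :=
  [ffun p => if touches a.1 p then behead (f p) else f p].
Definition top a f := [forall p, touches a.1 p ==> (ohead (f p) == Some a)].
Definition stacks0 : stacks := [ffun=> [::]].
Definition stacks_of w := foldr push stacks0 w.

Lemma topP a f :
  reflect (forall p, touches a.1 p -> ohead (f p) = Some a) (top a f).
Proof.
apply: (iffP forallP) => H p; first by move=> ap; apply/eqP/(implyP (H p)).
by apply/implyP => ap; rewrite H.
Qed.

Lemma touches_diag v : touches v (v, v).
Proof. by rewrite /touches eqxx e_irr. Qed.

(** Commuting letters touch disjoint sets of stacks; this is why all the
    operations below commute. *)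
Lemma touches_edge u v p : e u v -> touches u p -> touches v p = false.
Proof.
case: p => x y uv /andP[/= xyu xy]; apply/negbTE/negP => /andP[/= xyv _].
case/orP: xyu => /eqP E1; case/orP: xyv => /eqP E2; move: uv xy;
  by rewrite -E1 -E2 ?e_irr // => uv; rewrite ?uv // e_sym uv.
Qed.

Lemma touches_nonedge u v : ~~ e u v -> touches u (u, v) && touches v (u, v).
Proof. by move=> uv; rewrite /touches /= !eqxx uv orbT. Qed.

Lemma top_push a f : top a (push a f).
Proof. by apply/topP => p ap; rewrite ffunE ap. Qed.

Lemma push_pop a f : top a f -> push a (pop a f) = f.
Proof.
move=> /topP af; apply/ffunP => p; rewrite !ffunE; case: ifP => [ap|-> //].
by rewrite ap; move: (af p ap); case: (f p) => //= b s [->].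
Qed.

Lemma pop_push a f : pop a (push a f) = f.
Proof. by apply/ffunP => p; rewrite !ffunE; case: (touches _ _). Qed.

Lemma top_edge a b f : top a f -> top b f -> a != b -> e a.1 b.1.
Proof.
move=> /topP af /topP bf; apply: contra_neqT => /touches_nonedge/andP[ta tb].
by have := bf _ tb; rewrite af // => -[].
Qed.

Lemma top_push_edge a b f : top a (push b f) -> a != b -> e a.1 b.1.
Proof. by move=> /top_edge; apply; exact: top_push. Qed.

Lemma top_stacks0 a : top a stacks0 = false.
Proof. by apply/negP => /topP/(_ _ (touches_diag _)); rewrite ffunE. Qed.

Section Commutation.
Variables a b : letter.
Hypothesis ab : e a.1 b.1.

Lemma pushC f : push a (push b f) = push b (push a f).
Proof.
apply/ffunP => p; rewrite !ffunE; case: (boolP (touches a.1 p)) => // ap.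
by rewrite (touches_edge ab ap).
Qed.

Lemma pop_pushC f : pop a (push b f) = push b (pop a f).
Proof.
apply/ffunP => p; rewrite !ffunE; case: (boolP (touches a.1 p)) => // ap.
by rewrite (touches_edge ab ap).
Qed.

Lemma popC f : pop a (pop b f) = pop b (pop a f).
Proof.
apply/ffunP => p; rewrite !ffunE; case: (boolP (touches a.1 p)) => // ap.
by rewrite (touches_edge ab ap).
Qed.

Lemma top_pushC f : top a (push b f) = top a f.
Proof.
apply: eq_forallb => p; rewrite ffunE.
by case: (boolP (touches a.1 p)) => //= ap; rewrite (touches_edge ab ap).
Qed.

Lemma top_popC f : top a (pop b f) = top a f.
Proof.
apply: eq_forallb => p; rewrite ffunE.
by case: (boolP (touches a.1 p)) => //= ap; rewrite (touches_edge ab ap).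
Qed.

End Commutation.

Fixpoint reduced w :=
  if w is a :: w' then reduced w' && ~~ top (invl a) (stacks_of w') else true.

(** A letter lies on exactly one diagonal stack. *)
Lemma size_stacks_of w : size w = (\sum_v size (stacks_of w (v, v)))%N.
Proof.
elim: w => [|a w IH]; first by rewrite big1 // => v _; rewrite ffunE.
rewrite /= IH (bigD1 a.1) //= [RHS](bigD1 a.1) //= !ffunE touches_diag /= addSn.
congr (_ + _).+1; apply: eq_bigr => v va; rewrite ffunE.
by rewrite /touches /= orbb (negbTE va).
Qed.

Local Notation val w := (word_class (raag_rels e) w : raag e).
Definition gen a : raag e := val [:: a].

Lemma val_cat (u w : gword V) : val (u ++ w) = (val u * val w)%g.
Proof.
by apply/word_classP/pres_eq_cat2; apply: pres_sym; exact: pres_eq_repr.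
Qed.

Lemma val_cons a w : val (a :: w) = (gen a * val w)%g.
Proof. by rewrite -cat1s val_cat. Qed.

Lemma gen_inv a : gen (invl a) = (gen a)^-1%g.
Proof.
apply/(mulgI (gen a)); rewrite mulgV -val_cat; apply/word_classP.
exact: (pres_free _ [::] a [::]).
Qed.

Lemma gen_commute a b : e a.1 b.1 -> commute (gen a) (gen b).
Proof.
have pos u v : e u v -> commute (gen (u, false)) (gen (v, false)).
  move=> uv; apply/commgP/eqP.
  pose r := [:: (u, true); (v, true); (u, false); (v, false)].
  have : val r = 1%g.
    by apply/word_classP/(@pres_rel _ (raag_rels e) [::] r [::]); exists u, v.
  rewrite /r.
  rewrite !val_cons (_ : val [::] = 1%g) // mulg1.
  rewrite -[(u, true)]/(invl (u, false)) -[(v, true)]/(invl (v, false)) !gen_inv.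
  by rewrite /commg /conjg !mulgA.
case: a b => [u i] [v j] /= uv.
have neg x k : gen (x, k) = if k then (gen (x, false))^-1%g else gen (x, false).
  by case: k => //; rewrite -gen_inv.
rewrite (neg u) (neg v); have c := pos _ _ uv.
by case: i; case: j => //; [apply/commuteV/commute_sym/commuteV/commute_sym
  |apply/commute_sym/commuteV/commute_sym|exact: commuteV].
Qed.

(** A letter on top of all its stacks commutes with all letters before its
    first occurrence, so that it can be moved to the front of the word. *)
Lemma reduced_extract a w : reduced w -> top a (stacks_of w) ->
  exists w', [/\ reduced w', stacks_of w' = pop a (stacks_of w),
    ~~ top (invl a) (pop a (stacks_of w)), size w = (size w').+1 &
    val w = (gen a * val w')%g].
Proof.
elim: w => [|b w IH] /=; first by rewrite top_stacks0.
move=> /andP[w_red bw] aw; have [ab|ab] := eqVneq a b.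
  by rewrite ab pop_push val_cons; exists w; rewrite bw.
have eab := top_push_edge aw ab.
have eba : e b.1 a.1 by rewrite e_sym.
move: aw; rewrite top_pushC // => aw.
have [w' [w'_red w'E aw' szw' valw]] := IH w_red aw.
exists (b :: w'); split=> /=.
- by rewrite w'_red w'E top_popC.
- by rewrite w'E pop_pushC.
- by rewrite pop_pushC // top_pushC.
- by rewrite szw'.
- by rewrite !val_cons valw !mulgA gen_commute.
Qed.

Lemma reduced_inj (u w : gword V) : reduced u -> reduced w ->
  stacks_of u = stacks_of w -> val u = val w.
Proof.
move=> u_red w_red uw; have := size_stacks_of u; rewrite uw -size_stacks_of => szE.
elim: u => [|a u IH] in w u_red w_red uw szE *; first by case: w szE w_red uw.
have aw : top a (stacks_of w) by rewrite -uw top_push.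
have [w' [w'_red w'E _ sz valw]] := reduced_extract w_red aw.
rewrite valw val_cons; congr (_ * _)%g; apply: IH => //.
- by case/andP: u_red.
- by rewrite w'E -uw /= pop_push.
- by move: szE; rewrite sz => -[].
Qed.

Lemma reduced_exists w : exists u,
  [/\ reduced u, val u = val w & (size u <= size w)%N].
Proof.
elim: w => [|a w [u [u_red uw szu]]]; first by exists [::].
case: (boolP (top (invl a) (stacks_of u))) => au; last first.
  by exists (a :: u); split; rewrite /= ?u_red // !val_cons uw.
have [u' [u'_red _ _ sz valu]] := reduced_extract u_red au.
exists u'; split=> //; last by rewrite sz in szu; rewrite /= ltnW // ltnW.
by rewrite val_cons -uw valu gen_inv mulgA mulgV mul1g.
Qed.

(** Left multiplication by a letter, on stacks. *)
Definition act a f := if top (invl a) f then pop (invl a) f else push a f.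

Definition reachable f := exists2 w, reduced w & stacks_of w = f.

Lemma act_reachable a f : reachable f -> reachable (act a f).
Proof.
move=> [w w_red <-]; rewrite /act; case: ifPn => aw.
  by have [w' []] := reduced_extract w_red aw; exists w'.
by exists (a :: w); rewrite /= ?w_red.
Qed.

Lemma acts_reachable w f : reachable f -> reachable (foldr act f w).
Proof. by move=> Rf; elim: w => //= a w; exact: act_reachable. Qed.

Lemma actK a f : reachable f -> act (invl a) (act a f) = f.
Proof.
move=> [w w_red <-]; rewrite {2}/act; case: ifPn => aw.
  have [_ [_ _ + _ _]] := reduced_extract w_red aw.
  by rewrite /act invlK => /negbTE ->; rewrite push_pop.
by rewrite /act invlK top_push pop_push.
Qed.

Lemma actKV a f : reachable f -> act a (act (invl a) f) = f.
Proof. by move=> /(actK (invl a)); rewrite invlK. Qed.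

Lemma actC a b f : e a.1 b.1 -> act a (act b f) = act b (act a f).
Proof.
move=> ab; have ba : e b.1 a.1 by rewrite e_sym.
rewrite /act; case: (boolP (top (invl b) f)) => bf; case: (boolP (top (invl a) f)) => af.
- by rewrite !top_popC // af bf popC.
- by rewrite top_popC // (negbTE af) top_pushC // bf pop_pushC.
- by rewrite top_popC // (negbTE bf) top_pushC // af pop_pushC.
- by rewrite !top_pushC // (negbTE af) (negbTE bf) pushC.
Qed.

(** The group acts on reachable stacks: free cancellations act trivially by
    [actK], commutators by [actC]. *)
Lemma acts_pres_eq (u w : gword V) f : pres_eq (raag_rels e) u w -> reachable f ->
  foldr act f u = foldr act f w.
Proof.
move=> uw; elim: uw f => {u w} [w|u w _ IH|v u w _ IH1 _ IH2|u a w|u r w [x [y [xy ->]]]] f.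
- by [].
- by move=> Rf; rewrite (IH _ Rf).
- by move=> Rf; rewrite (IH1 _ Rf) (IH2 _ Rf).
- by move=> Rf; rewrite !foldr_cat /= actKV //; exact: acts_reachable.
- move=> Rf; rewrite !foldr_cat /=.
  have Rw := acts_reachable w Rf; move: (foldr act f w) Rw => {Rf w}f Rf.
  rewrite (actC (a := (y, true)) (b := (x, false))); last by rewrite /= e_sym.
  rewrite -[(x, true)]/(invl (x, false)) -[(y, true)]/(invl (y, false)).
  by rewrite !actK //; do 2?apply: act_reachable.
Qed.

Lemma acts_reduced w : reduced w -> foldr act stacks0 w = stacks_of w.
Proof.
by elim: w => //= a w IH /andP[w_red aw]; rewrite IH // /act (negbTE aw).
Qed.

Lemma reduced_val (u w : gword V) : reduced u -> reduced w ->
  val u = val w <-> stacks_of u = stacks_of w.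
Proof.
move=> u_red w_red; split; last exact: reduced_inj.
move=> /word_classP uw; rewrite -!acts_reduced //; apply: acts_pres_eq => //.
by exists [::].
Qed.

End Stacks.

(** * Counting spheres *)

(** Lets the values of reduced words be counted through their stacks. *)
Lemma size_undup_map_eq (A B C : eqType) (f : A -> B) (g : A -> C) (s : seq A) :
  {in s &, forall x y, f x = f y <-> g x = g y} ->
  size (undup (map f s)) = size (undup (map g s)).
Proof.
elim: s => //= x s IH fg.
have -> : (f x \in map f s) = (g x \in map g s).
  apply/mapP/mapP => -[y ys E]; exists y => //; apply/fg => //;
    by rewrite inE ?eqxx ?ys ?orbT.
have {}IH : size (undup (map f s)) = size (undup (map g s)).
  by apply: IH => y z ys zs; apply: fg; rewrite inE ?ys ?zs orbT.
by case: ifP => _ /=; rewrite IH.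
Qed.

Section Spheres.
Variables (V : finType) (e : rel V).
Hypothesis e_sym : symmetric e.
Hypothesis e_irr : irreflexive e.

Local Notation letter := (V * bool)%type.
Local Notation stacks := (stacks V).
Implicit Types (a b : letter) (w : gword V) (f h : stacks) (U L : {set V}).
Local Notation val w := (word_class (raag_rels e) w : raag e).

Lemma raag_gens_gen a : raag_gens (gen e a).
Proof.
case: a => v [|]; exists v; [right|by left].
by rewrite -[(v, true)]/(invl (v, false)) gen_inv.
Qed.

Lemma represents_val w : represents (@raag_gens V e) (map (gen e) w) (val w).
Proof.
split=> [s /mapP[a _ ->]|]; first exact: raag_gens_gen.
rewrite big_map; elim: w => [|a w IH]; first by rewrite big_nil.
by rewrite big_cons IH val_cons.
Qed.

Lemma represents_word (s : seq (raag e)) g : represents (@raag_gens V e) s g ->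
  exists2 w, val w = g & size w = size s.
Proof.
move=> [sS <-] {g}; elim: s => [|x s IH] in sS *.
  by exists [::]; rewrite ?big_nil.
have [w wE sz] := IH (fun y ys => sS y (mem_behead (s := x :: s) ys)).
have [a aE] : exists a, x = gen e a.
  have [v [->|->]] := sS x (mem_head _ _); first by exists (v, false).
  by exists (v, true); rewrite -[(v, true)]/(invl (v, false)) gen_inv.
by exists (a :: w); rewrite /= ?sz // val_cons wE aE big_cons.
Qed.

(** Reduction never lengthens a word, and the stacks, which depend only on the
    value of a reduced word, determine its length; so the reduced words are the
    geodesics. *)
Lemma has_word_lengthP g l : has_word_length (@raag_gens V e) g l <->
  exists w, [/\ reduced e w, val w = g & size w = l].
Proof.
have min w u : reduced e w -> val u = val w -> (size w <= size u)%N.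
  move=> w_red uw; have [u' [u'_red u'E szu']] := reduced_exists e_sym e_irr u.
  have /(reduced_val e_sym e_irr w_red u'_red) wu' : val w = val u' by rewrite u'E.
  by rewrite (size_stacks_of e_irr) wu' -(size_stacks_of e_irr).
split=> [[[s [/represents_word[u <- su] sl]] lmin]|[w [w_red <- <-]]].
  have [w [w_red wE szw]] := reduced_exists e_sym e_irr u; exists w; split=> //.
  apply/eqP; rewrite eqn_leq -{1}sl -su szw -(size_map (gen e)) lmin //.
  by rewrite -wE; exact: represents_val.
split; first by exists (map (gen e) w); rewrite size_map; split=> //; exact: represents_val.
by move=> s /represents_word[u uw <-]; exact: min.
Qed.

Definition reduced_words l : seq (gword V) :=
  [seq w <- [seq tval t | t : l.-tuple letter] | reduced e w].

Lemma mem_reduced_words l w :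
  (w \in reduced_words l) = reduced e w && (size w == l).
Proof.
rewrite mem_filter; congr (_ && _); apply/mapP/eqP => [[t _ ->]|<-].
  exact: size_tuple.
by exists (in_tuple w); rewrite ?mem_enum.
Qed.

Definition sphere l : seq stacks := undup [seq stacks_of e w | w <- reduced_words l].

Lemma sphereP l f :
  reflect (exists w, [/\ reduced e w, size w = l & stacks_of e w = f]) (f \in sphere l).
Proof.
rewrite mem_undup; apply: (iffP mapP) => [[w + ->]|[w [w_red wl <-]]].
  by rewrite mem_reduced_words => /andP[? /eqP]; exists w.
by exists w; rewrite // mem_reduced_words w_red wl eqxx.
Qed.

Lemma sphere_cardE l : sphere_card (@raag_gens V e) l = size (sphere l).
Proof.
rewrite /sphere_card.
have -> : [set g | has_word_length (@raag_gens V e) g l]%classic =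
    [set` [fset x in [seq val w | w <- reduced_words l]]%fset]%classic.
  apply/seteqP; split=> g /=.
    move=> /has_word_lengthP[w [w_red <- wl]]; rewrite in_fset.
    by apply: map_f; rewrite mem_reduced_words w_red wl eqxx.
  rewrite in_fset => /mapP[w]; rewrite mem_reduced_words => /andP[w_red /eqP wl] ->.
  by apply/has_word_lengthP; exists w.
rewrite set_fsetK card_fseq; apply: size_undup_map_eq => u w.
rewrite !mem_reduced_words => /andP[ur _] /andP[wr _]; exact: reduced_val.
Qed.

(** Pushing [a] is a bijection from the stacks of length [l] without [a^-1] on
    top to the stacks of length [l.+1] with [a] on top. *)
Lemma sphere_peel a (P Q : pred stacks) l :
  (forall h, P (push e a h) = Q h) ->
  count (fun f => top e a f && P f) (sphere l.+1) =
  count (fun h => ~~ top e (invl a) h && Q h) (sphere l).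
Proof.
move=> PQ; rewrite -!size_filter -[RHS](size_map (push e a)); apply/perm_size/uniq_perm.
- by rewrite filter_uniq // undup_uniq.
- rewrite map_inj_uniq ?filter_uniq ?undup_uniq //.
  exact: can_inj (@pop_push _ e a).
move=> f; rewrite mem_filter; apply/idP/mapP.
  move=> /andP[/andP[af Pf] /sphereP[w [w_red wl wf]]].
  have aw : top e a (stacks_of e w) by rewrite wf.
  have [w' [w'_red w'E aw' sz _]] := reduced_extract e_sym e_irr w_red aw.
  exists (pop e a f); last by rewrite push_pop.
  rewrite mem_filter -PQ push_pop // Pf -wf aw'; apply/sphereP; exists w'.
  by split=> //; move: sz; rewrite wl => -[].
move=> [h + ->]; rewrite mem_filter -PQ => /andP[/andP[ah ->] /sphereP[w [w_red wl wh]]].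
rewrite top_push; apply/sphereP; exists (a :: w); split=> /=.
- by rewrite w_red wh.
- by rewrite wl.
- by rewrite wh.
Qed.

(** No geodesic with these stacks starts at a vertex of [U]. *)
Definition avoids U f := [forall a : letter, top e a f ==> (a.1 \notin U)].

Lemma avoidsP U f : reflect (forall a, top e a f -> a.1 \notin U) (avoids U f).
Proof.
by apply: (iffP forallP) => H a; [move/implyP: (H a)|apply/implyP/H].
Qed.

(** Besides [a], only letters that commute with [a] can be on top. *)
Lemma avoids_push a U h : a.1 \notin U ->
  avoids U (push e a h) = avoids (nbr e a.1 U) h.
Proof.
move=> aU; apply/avoidsP/avoidsP => H b bh.
  rewrite !inE; apply/negP => /andP[bU ab].
  by have := H b; rewrite top_pushC ?bU //= 1?e_sym // => /(_ bh).
have [->//|ba] := eqVneq b a; have eba := top_push_edge bh ba.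
move: bh; rewrite top_pushC // => /H; rewrite !inE [e _ _]e_sym eba andbT //.
Qed.

Definition avoid_count U l := count (avoids U) (sphere l).
Definition start_count a U l :=
  count (fun f => top e a f && avoids U f) (sphere l).

Lemma start_count0 a U : start_count a U 0 = 0%N.
Proof.
apply/eqP; rewrite -leqn0 leqNgt -has_count; apply/hasPn => f.
by move=> /sphereP[[|b w] [_ sz <-]] //; rewrite /= top_stacks0.
Qed.

Lemma start_countS a U l : a.1 \notin U ->
  (start_count a U l.+1 + start_count (invl a) (nbr e a.1 U) l =
   avoid_count (nbr e a.1 U) l)%N.
Proof.
move=> aU; rewrite /start_count (sphere_peel _ (fun h => avoids_push h aU)).
rewrite /avoid_count; elim: (sphere l) => //= h s <-.
by case: (top e (invl a) h) => /=; lia.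
Qed.

Lemma nbr_nbr v U : nbr e v (nbr e v U) = nbr e v U.
Proof. by rewrite /nbr -setIA setIid. Qed.

Lemma notin_nbr v U : v \notin nbr e v U.
Proof. by rewrite !inE e_irr andbF. Qed.

Lemma start_count_nbr a U l : a.1 \notin U ->
  start_count a U l = start_count a (nbr e a.1 U) l.
Proof.
move=> aU; case: l => [|l]; first by rewrite !start_count0.
apply/eqP; rewrite -(eqn_add2r (start_count (invl a) (nbr e a.1 U) l)).
rewrite start_countS //; apply/eqP.
by have := start_countS l (notin_nbr a.1 U); rewrite nbr_nbr => ->.
Qed.

(** Both counts start at 0 and satisfy the recursion [start_countS], which is
    symmetric in [a] and its inverse. *)
Lemma start_count_inv a U l : a.1 \notin U ->
  start_count (invl a) U l = start_count a U l.
Proof.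
elim: l => [|l IH] aU; first by rewrite !start_count0.
have := start_countS (a := invl a) l aU; have := start_countS l aU.
rewrite invlK /= -!start_count_nbr // IH // => <- /addIn //.
Qed.

(** A letter and its inverse are never both on top of all their stacks, so the
    cases are exclusive. *)
Lemma avoid_count_setU1 v U l : v \notin U ->
  (avoid_count (v |: U) l + start_count (v, false) U l + start_count (v, true) U l
   = avoid_count U l)%N.
Proof.
move=> vU; rewrite /avoid_count /start_count.
have avE f : avoids (v |: U) f =
    [&& ~~ top e (v, false) f, ~~ top e (v, true) f & avoids U f].
  apply/avoidsP/and3P => [H|[f0 f1 /avoidsP H] [u b] ub].
    split; try by apply/negP => /H; rewrite /= setU11.
    by apply/avoidsP => a /H; rewrite !inE negb_or => /andP[].
  rewrite !inE negb_or H //= andbT; apply/eqP => uv; move: ub; rewrite uv.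
  by case: b; apply/negP.
elim: (sphere l) => //= f s IH; rewrite -IH avE.
have excl : ~~ (top e (v, false) f && top e (v, true) f).
  apply/negP => /andP[t0 t1].
  have ne : (v, false) != (v, true) by rewrite xpair_eqE andbF.
  by have := top_edge t0 t1 ne; rewrite e_irr.
move: excl; case: (top e (v, false) f); case: (top e (v, true) f);
  case: (avoids U f) => //= _; lia.
Qed.

Notation X := (fpsX int).
Definition avoid_series U : fps int := Fps (fun l => (avoid_count U l)%:Z).
Definition start_series a U : fps int := Fps (fun l => (start_count a U l)%:Z).

Lemma start_seriesE a U : a.1 \notin U ->
  (1 + X) * start_series a U = X * avoid_series (nbr e a.1 U).
Proof.
move=> aU; rewrite mulrDl mul1r; apply/fpsP => -[|l]; rewrite fcoefD !fcoefXM.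
  by rewrite /= start_count0.
rewrite /= -start_countS // [in RHS]start_count_inv ?notin_nbr //.
by rewrite -start_count_nbr.
Qed.

Lemma avoid_series_setU1 v U : v \notin U ->
  (1 + X) * avoid_series (v |: U) =
  (1 + X) * avoid_series U - 2 * X * avoid_series (nbr e v U).
Proof.
move=> vU.
have -> : avoid_series U = avoid_series (v |: U) + start_series (v, false) U
    + start_series (v, true) U.
  by apply/fpsP => l; rewrite !fcoefD /= -(avoid_count_setU1 l vU).
rewrite !mulrDr !start_seriesE //=; ring.
Qed.

(** Both sides satisfy the same recursion for the deletion of a vertex. *)
Lemma avoid_seriesE U :
  (1 + X) ^+ #|U| * avoid_series U = series_of e U * avoid_series set0.
Proof.
move: {2}#|U| (leqnn #|U|) => n; elim: n U => [|n IH] U Un.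
  have -> : U = set0 by apply/eqP; rewrite -cards_eq0 -leqn0.
  by rewrite cards0 expr0 series_of0.
have [->|/set0Pn[v vU]] := eqVneq U set0; first by rewrite cards0 expr0 series_of0.
set U' := U :\ v; have vU' : v \notin U' by rewrite !inE eqxx.
have UE : U = v |: U' by rewrite setD1K.
have U'n : (#|U'| <= n)%N by move: Un; rewrite (cardsD1 v U) vU.
have LU' : (#|nbr e v U'| <= #|U'|)%N by apply/subset_leq_card/subsetIl.
rewrite UE series_of_setU1 // cardsU1 vU' add1n exprSr -mulrA.
rewrite avoid_series_setU1 // mulrBl -!mulrA -IH // -IH ?(leq_trans LU') //.
have -> : (1 + X) ^+ #|U'| = (1 + X) ^+ (#|U'| - #|nbr e v U'|) *
    (1 + X) ^+ #|nbr e v U'| by rewrite -exprD subnK.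
ring.
Qed.

Lemma avoid_seriesT : avoid_series [set: V] = 1.
Proof.
apply/fpsP => l; rewrite fcoef1 /= /avoid_count; case: l => [|l] /=.
  have -> : count (avoids [set: V]) (sphere 0) = size (sphere 0).
    apply/eqP; rewrite -all_count; apply/allP => f /sphereP[[|b w] [_ sz <-]] //.
    by apply/avoidsP => a; rewrite top_stacks0.
  congr (Posz _)%R; rewrite (perm_size (s2 := [:: stacks0 V])) //.
  apply: uniq_perm; rewrite ?undup_uniq // => f; rewrite inE.
  by apply/sphereP/eqP => [[[|b w] [_ sz <-]]|->] //; exists [::].
apply/eqP; rewrite eqz_nat -leqn0 leqNgt -has_count; apply/hasPn => f.
move=> /sphereP[[|a w] [_ sz <-]] //; apply/negP => /avoidsP/(_ a (top_push _ _ _)).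
by rewrite inE.
Qed.

Lemma sphere_cardE_series l :
  (sphere_card (@raag_gens V e) l)%:Z = fcoef ((1 + X) ^+ #|V| * inv_series e [set: V]) l.
Proof.
have A0 : (sphere_card (@raag_gens V e) l)%:Z = fcoef (avoid_series set0) l.
  rewrite sphere_cardE /= /avoid_count; congr Posz; symmetry; apply/eqP.
  rewrite -all_count; apply/allP => f _.
  by apply/avoidsP => a _; rewrite inE.
rewrite A0; congr (fcoef _ l); have := avoid_seriesE [set: V].
rewrite avoid_seriesT mulr1 cardsT => ->.
by rewrite mulrAC series_ofV mul1r.
Qed.

End Spheres.

(** * Growth rate and Perron numbers *)

Section CauchyHadamard.
Variable R : realType.

Lemma powR_root_le (x q : R) (l : nat) : 0 <= x -> 0 <= q -> (0 < l)%N ->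
  (x `^ l%:R^-1 <= q) = (x <= q ^+ l).
Proof.
move=> x0 q0 l0; have l1 : (0 : R) < l%:R by rewrite ltr0n.
have {2}<- : (x `^ l%:R^-1) ^+ l = x.
  by rewrite -powR_mulrn ?powR_ge0 // -powRrM mulVf ?lt0r_neq0 // powRr1.
by rewrite ler_pXn2r // nnegrE powR_ge0.
Qed.

(** The formula of Cauchy and Hadamard. If the limit superior were less than
    [rho^-1], comparison with a geometric series would give convergence at
    [rho]. *)
Lemma limn_esup_root (f : fps int) (a : nat -> nat) (rho : R) :
  (forall l, (a l)%:Z = fcoef f l) -> 0 < rho ->
  (forall r, 0 <= r < rho -> converges f r) -> ~ converges f rho ->
  limn_esup (fun l => ((a l)%:R `^ l%:R^-1)%:E) = (rho^-1)%:E.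
Proof.
move=> af rho0 sum_lt div_rho; set u := fun l => _.
have f0 : fps_nonneg f by move=> l; rewrite -af.
have aE l : (fcoef f l)%:~R = (a l)%:R :> R by rewrite -af.
have -> : limn_esup u = ereal_inf (range (esups u)).
  by rewrite limn_esup_lim; apply/cvg_lim => //; exact: cvg_esups_inf.
apply/le_anti/andP; split.
  apply/lee_addgt0Pr => eps eps0.
  pose q := rho^-1 + eps; have q0 : 0 < q by rewrite addr_gt0 ?invr_gt0.
  have qr : 0 <= q^-1 < rho.
    rewrite invr_ge0 (ltW q0) /= -[ltRHS]invrK ltf_pV2 ?posrE ?invr_gt0 //.
    by rewrite /q ltrDl.
  have [N HN] := psum_cauchy 1 f0 (andP qr).1 (sum_lt _ qr) ltr01.
  apply: (@le_trans _ _ (esups u N.+1)); first by apply: ereal_inf_lbound; exists N.+1.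
  apply: ge_ereal_sup => _ [l /= Nl <-]; rewrite -EFinD -/q /u lee_fin.
  rewrite powR_root_le ?ler0n ?(ltW q0) //; last by lia.
  have := HN l.+1 ltac:(lia); rewrite subn1 /= psumS addrAC subrr add0r aE.
  by rewrite exprVn ltr_pdivrMr ?exprn_gt0 // mul1r => /ltW.
apply: le_ereal_inf_tmp => _ [N _ <-]; rewrite leNgt; apply/negP => lt_rho.
have uN l : (N <= l)%N -> (u l <= esups u N)%E.
  by move=> Nl; apply: ereal_sup_ubound; exists l.
have [q qE] : exists q, esups u N = q%:E.
  have := uN N (leqnn _); move: lt_rho; case: (esups u N) => [q|//|//] _ _.
  by exists q.
move: lt_rho; rewrite qE lte_fin => q_rho.
have q0 : 0 <= q.
  by rewrite -lee_fin -qE; apply: le_trans (uN N (leqnn _)); rewrite lee_fin powR_ge0.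
pose b := q * rho; have b0 : 0 <= b by rewrite mulr_ge0 // ltW.
have b1 : b < 1 by rewrite /b -ltr_pdivlMr // div1r.
apply: div_rho; exists (psum f N.+1 rho + (1 - b)^-1).
suff H n : (N.+1 <= n)%N -> psum f n rho <= psum f N.+1 rho + (1 - b ^+ n) / (1 - b).
  move=> n; apply: (@le_trans _ _ (psum f (n + N.+1) rho)).
    by apply: psum_nd (ltW rho0) (leq_addr _ _).
  apply: le_trans (H _ (leq_addl _ _)) _; rewrite lerD2l.
  by rewrite ler_piMl ?gerBl ?exprn_ge0 // invr_ge0 subr_ge0 ltW.
elim: n => // n IH; rewrite leq_eqVlt => /predU1P[<-|Nn].
  by rewrite lerDl divr_ge0 ?subr_ge0 ?exprn_ile1 // ltW.
have an : (a n)%:R <= q ^+ n :> R.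
  by rewrite -powR_root_le ?ler0n //; [rewrite -lee_fin -qE; apply: uN; lia|lia].
rewrite psumS aE.
have : (a n)%:R * rho ^+ n <= b ^+ n :> R.
  by rewrite exprMn ler_wpM2r ?exprn_ge0 // ltW.
have := IH Nn.
have -> : (1 - b ^+ n.+1) / (1 - b) = (1 - b ^+ n) / (1 - b) + b ^+ n.
  by rewrite exprS; field; rewrite subr_eq0 eq_sym lt_eqF.
lra.
Qed.

End CauchyHadamard.

Section Algebraic.

Definition rev_poly (p : {poly int}) : {poly int} :=
  \poly_(i < size p) p`_((size p).-1 - i).

Lemma rev_poly_monic (p : {poly int}) : p`_0 = 1 -> rev_poly p \is monic.
Proof.
move=> p0; have sp : (0 < size p)%N.
  by rewrite lt0n; apply/eqP => /eqP; rewrite size_poly_eq0 => /eqP pE;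
    move: p0; rewrite pE coef0.
rewrite monicE /rev_poly -(prednK sp) lead_coef_poly //= subnn p0 //.
Qed.

Lemma evalz_rev_poly (F : fieldType) (p : {poly int}) (x : F) : x != 0 ->
  evalz (rev_poly p) x = x ^+ (size p).-1 * evalz p x^-1.
Proof.
move=> x0; rewrite (@evalzE _ _ _ (size p)) ?size_poly // (evalzE _ (leqnn _)).
rewrite mulr_sumr (reindex_inj rev_ord_inj) /=; apply: eq_bigr => i _.
have nat_eqs n k : (k < n)%N ->
    [/\ n - k.+1 < n, n.-1 - (n - k.+1) = k & n.-1 = (n - k.+1) + k]%N.
  by move=> kn; split; lia.
have [lt_i sub_i add_i] := nat_eqs _ _ (ltn_ord i).
rewrite coef_poly lt_i sub_i mulrCA add_i; congr (_ * _).
by rewrite exprD -mulrA -exprMn divff // expr1n mulr1.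
Qed.

(** The minimal polynomial of [z] divides every polynomial that vanishes at
    [z]. *)
Lemma conjugate_root (C : numClosedFieldType) (q : {poly int}) (z w : C) :
  galois_conjugate z w -> evalz q z = 0 -> evalz q w = 0.
Proof.
move=> [p [p_monic p_irr pz pw]] qz.
pose q' : {poly rat} := map_poly intr q.
have qE (x : C) : evalz q x = (map_poly ratr q').[x].
  rewrite /evalz; congr (_.[x]); apply/polyP => i.
  by rewrite /q' !coef_map /= ratr_int.
have : p %| q'.
  apply: contraT; rewrite -(irreducible_poly_coprime _ p_irr).
  rewrite -(coprimep_map (ratr : rat -> C)) => /coprimep_root/(_ pz)/eqP.
  by rewrite -qE qz.
by rewrite -(dvdp_map (ratr : rat -> C)) => /dvdpP[c cE]; rewrite qE cE hornerM
  (rootP pw) mulr0.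
Qed.

(** The other conjugates of [rho^-1] are roots of the reversed polynomial, which is
    monic; their inverses are roots of [p] and have larger modulus than [rho]. *)
Lemma perron_inv (R : realType) (p : {poly int}) (rho : R) :
  p`_0 = 1 -> 0 < rho < 1 -> evalz p rho = 0 ->
  (forall t : R[i], evalz p t = 0 -> `|t| <= rho%:C -> t = rho%:C) ->
  perron rho^-1.
Proof.
move=> p0 /andP[rho0 rho1] p_rho p_uniq.
have root_rev : evalz (rev_poly p) rho^-1 = 0.
  by rewrite evalz_rev_poly ?invr_eq0 ?lt0r_neq0 // invrK p_rho mulr0.
split.
- exists (rev_poly p); first exact: rev_poly_monic.
  exact/rootP.
- by rewrite invf_gt1.
move=> z /conjugate_root conj zrho.
have {conj} : evalz (rev_poly p) z = 0 by apply: conj; rewrite evalz_realC root_rev.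
have rhoV : `|(rho^-1)%:C| = (rho^-1)%:C by rewrite ger0_norm ?lecR ?invr_ge0 ?ltW.
have [-> _|z0] := eqVneq z 0.
  by rewrite normr0 rhoV ltcR invr_gt0.
rewrite evalz_rev_poly // => /eqP; rewrite mulf_eq0 expf_eq0 (negbTE z0) andbF /=.
move=> /eqP zV; rewrite rhoV; have [r rE] := norm_realC z.
have r0 : 0 < r by rewrite -ltcR -rE normr_gt0.
rewrite rE ltcR ltNge; apply/negP => rho_r.
have /(congr1 (fun x => x^-1)) : z^-1 = rho%:C.
  apply: p_uniq zV _; rewrite normfV rE -fmorphV lecR.
  by rewrite -[leRHS]invrK lef_pV2 ?posrE ?invr_gt0.
by rewrite invrK -fmorphV => /eqP; rewrite (negbTE zrho).
Qed.

End Algebraic.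

Theorem theoremC (R : realType) (V : finType) (e : rel V)
    (e_sym : symmetric e) (e_irr : irreflexive e) (V_gt0 : (0 < #|V|)%N) :
  growth_rate (@raag_gens V e) R = (1%:E)%E \/
  (exists2 x : R, growth_rate (@raag_gens V e) R = (x%:E)%E & perron x).
Proof.
have [rho dom] := clique_poly_dominant R e_sym [set: V].
case=> [[/setP VT _]|[rt rho1]].
  by have /card_gt0P[v _] := V_gt0; have := VT v; rewrite !inE.
have [rho0 sumW uniq_rho] := dom.
pose A := fps_of_poly ((1 + 'X) ^+ #|V|) * inv_series e [set: V].
have aA l : (sphere_card (@raag_gens V e) l)%:Z = fcoef A l.
  by rewrite sphere_cardE_series // /A rmorphXn rmorphD rmorph1.
have A_ge0 : fps_nonneg A by move=> l; rewrite -aA.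
have growth : growth_rate (@raag_gens V e) R = (rho^-1)%:E.
  apply: (limn_esup_root aA rho0) => [r /andP[r0 r_rho]|sumA].
    apply: (converges_polyM _ r0 (erefl A)); first exact: inv_series_nonneg.
    by apply: sumW; rewrite r0.
  have [L AL] := converges_sum A_ge0 (ltW rho0) sumA.
  have DA : fps_of_poly (clique_poly e [set: V]) * A = fps_of_poly ((1 + 'X) ^+ #|V|).
    by rewrite /A mulrCA series_ofV mulr1.
  have := evalz_sum A_ge0 (ltW rho0) DA AL; rewrite rt mul0r => /eqP.
  rewrite /evalz rmorphXn rmorphD rmorph1 /= map_polyX !hornerE eq_sym expf_eq0.
  by rewrite paddr_eq0 ?ltW // oner_eq0 andbF.
move: rho1; rewrite le_eqVlt => /predU1P[rhoE|rho1].
  by left; rewrite growth rhoE invr1.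
right; exists rho^-1 => //; apply: (@perron_inv _ (clique_poly e [set: V])) => //.
- exact: clique_poly_coef0.
- by rewrite rho0.
Qed.
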